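(* (1) A rank $R$ (on a class of complete types) with Bounded multiplicity and Extension satisfies the reciprocal of the forking rank property: a non-forking extension of a ranked type has the same rank. (2) A rank $R$ (on a class of complete types), all of whose ranked types are simple, and which satisfies the reciprocal of the forking rank property, has Extension.
   Context: $T$ is a complete first-order theory in a language $L$ with a monster model $\mathfrak C$ that is $\bar\kappa$-saturated and strongly $\bar\kappa$-homogeneous for a sufficiently large cardinal $\bar\kappa$ (e.g. strongly inaccessible). All parameter sets are small subsets of $\mathfrak C$ (cardinality $<\bar\kappa$), and cardinals quantified over in the definitions below are small. Complete types are finitary. A class of complete types is a class $\mathfrak A$ of complete types closed under complete extensions and under conjugation by automorphisms of $\mathfrak C$. A rank on $\mathfrak A$ is a mapping $R:\mathfrak A\to\mathrm{Ord}\cup\{\infty\}$ with Heredity ($p\subseteq q$ implies $R(p)\ge R(q)$) and Isomorphism ($R(p)=R(p^f)$ for $f\in Aut(\mathfrak C)$); $p$ is ranked if $R(p)<\infty$. $R$ has Bounded multiplicity if for each ranked $p\in\mathfrak A$, $p\in S(A)$, there is a cardinal $\kappa$ such that for any $B\supseteq A$, $p$ has at most $\kappa$ different extensions $q\in S(B)$ with $R(q)=R(p)$. $R$ has Extension if for every ranked $p\in S(A)$ in $\mathfrak A$ and every $B\supseteq A$ there is an extension $q\in S(B)$ of $p$ with $R(p)=R(q)$. $R$ satisfies the reciprocal of the forking rank property if for all $p\in S(A)$, $q\in S(B)$ in $\mathfrak A$ with $p\subseteq q$, $p$ ranked and $q$ not forking over $A$, one has $R(q)=R(p)$. A (partial)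 type $p(x)$ is simple if there are no formula $\varphi(x,y)\in L$, $k\ge 2$ and tree $(a_s:s\in\omega^{<\omega})$ such that for every $f\in\omega^\omega$, $p(x)\cup\{\varphi(x,a_{f\upharpoonright n}):n\ge1\}$ is consistent, and for every $s\in\omega^{<\omega}$, $\{\varphi(x,a_{s^\frown j}):j\in\omega\}$ is $k$-inconsistent. *)

(* Defs.v *)
From mathcomp Require Import all_boot all_order all_classical.

Set Implicit Arguments.
Unset Strict Implicit.
Unset Printing Implicit Defensive.

Local Open Scope card_scope.
Local Open Scope classical_set_scope.

Definition card_lt (X Y : Type) (A : set X) (B : set Y) : Prop :=
  A #<= B /\ ~ (B #<= A).

(* |K| is an uncountable strong limit; every cardinal below |K| is the
   cardinality of a subset of K. *)
Definition uncountable_strong_limit (K : Type) : Prop :=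
  card_lt [set: nat] [set: K] /\
  forall X : set K, card_lt X [set: K] ->
    card_lt [set Y : set K | Y `<=` X] [set: K].

Record language : Type := Language {
  fsym : Type;
  farity : fsym -> nat;
  rsym : Type;
  rarity : rsym -> nat }.

Section Syntax.
Variable L : language.

Inductive term (V : Type) : Type :=
  | tVar of V
  | tApp (f : fsym L) of ('I_(farity f) -> term V).

(* [formula V] : free variables in V.  The quantifier [fEx] binds the new
   variable [None : option V]. *)
Inductive formula (V : Type) : Type :=
  | fEq of term V & term V
  | fRel (r : rsym L) of ('I_(rarity r) -> term V)
  | fNot of formula V
  | fAnd of formula V & formula V
  | fEx of formula (option V).

Record structure : Type := Structure {
  carrier :> Type;
  carrier_inhabited : inhabited carrier;
  finterp : forall f : fsym L, ('I_(farity f) -> carrier) -> carrier;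
  rinterp : forall r : rsym L, ('I_(rarity r) -> carrier) -> Prop }.

Fixpoint teval (M : structure) (V : Type) (v : V -> M) (t : term V) : M :=
  match t with
  | tVar x => v x
  | tApp f ts => finterp (fun i => teval v (ts i))
  end.

Fixpoint sat (M : structure) (V : Type) (phi : formula V) : (V -> M) -> Prop :=
  match phi with
  | fEq t u => fun v => teval v t = teval v u
  | fRel r ts => fun v => rinterp (fun i => teval v (ts i))
  | fNot psi => fun v => ~ sat psi v
  | fAnd psi chi => fun v => sat psi v /\ sat chi v
  | fEx psi => fun v => exists b : M, sat psi (oapp v b)
  end.

Definition sentence : Type := formula void.

Definition models (M : structure) (T : set sentence) : Prop :=
  forall s, T s -> sat s (fun x : void => match x return M with end).

Definition theory_entails (T : set sentence) (s : sentence) : Prop :=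
  forall M : structure, models M T -> models M [set s].

Definition complete_theory (T : set sentence) : Prop :=
  (exists M : structure, models M T) /\
  forall s, theory_entails T s \/ theory_entails T (fNot s).

End Syntax.

Section Types.
Variables (L : language) (M : structure L).

(* An L(M)-formula phi(x, a) in the variables x = (x_i)_{i < n}: an L-formula
   phi(x, y) together with a finite tuple a of parameters for y. *)
Record pformula (n : nat) : Type := PFormula {
  plen : nat;
  pfml : formula L ('I_n + 'I_plen);
  ppar : 'I_plen -> M }.

Arguments ppar {n} p _.

Definition psat (n : nat) (c : 'I_n -> M) (psi : pformula n) : Prop :=
  sat (pfml psi)
    (fun v => match v with inl i => c i | inr j => ppar psi j end).

Definition pneg (n : nat) (psi : pformula n) : pformula n :=
  PFormula (fNot (pfml psi)) (ppar psi).

Definition over (n : nat) (A : set M) (psi : pformula n) : Prop :=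
  forall j, A (ppar psi j).

Definition realizes (n : nat) (c : 'I_n -> M) (p : set (pformula n)) : Prop :=
  forall psi, p psi -> psat c psi.

(* Consistency is with the elementary diagram of M, i.e. finite
   satisfiability in M. *)
Definition consistent (n : nat) (p : set (pformula n)) : Prop :=
  forall F, finite_set F -> F `<=` p -> exists c, realizes c F.

(* p \in S_n(A) *)
Definition complete_type (n : nat) (A : set M) (p : set (pformula n)) : Prop :=
  [/\ p `<=` over A,
      consistent p
    & forall psi, over A psi -> p psi \/ p (pneg psi)].

Definition tp (n : nat) (A : set M) (c : 'I_n -> M) : set (pformula n) :=
  [set psi | over A psi /\ psat c psi].

Definition automorphism (f : M -> M) : Prop :=
  [/\ bijective f,
      forall (g : fsym L) (v : 'I_(farity g) -> M),
        f (finterp v) = finterp (f \o v)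
    & forall (r : rsym L) (v : 'I_(rarity r) -> M),
        rinterp v <-> rinterp (f \o v)].

(* p^f *)
Definition conj_type (n : nat) (f : M -> M) (p : set (pformula n)) :
    set (pformula n) :=
  (fun psi => PFormula (pfml psi) (f \o ppar psi)) @` p.

Definition elementary_on (A : set M) (f : M -> M) : Prop :=
  forall (m : nat) (phi : formula L 'I_m) (a : 'I_m -> M),
    (forall j, A (a j)) -> (sat phi a <-> sat phi (f \o a)).

(* Distinctness is of the indices, not of the formulas: a family with
   repetitions is not identified with its set of values. *)
Definition k_inconsistent (n : nat) (k : nat) (F : nat -> pformula n) : Prop :=
  forall i : 'I_k -> nat, injective i ->
    ~ exists c, forall l, psat c (F (i l)).

Definition divides (n : nat) (A : set M) (psi : pformula n) : Prop :=
  exists (k : nat) (b : nat -> 'I_(plen psi) -> M),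
    (forall i, tp A (b i) = tp A (ppar psi)) /\
    k_inconsistent k (fun i => PFormula (pfml psi) (b i)).

Definition forks (n : nat) (A : set M) (q : set (pformula n)) : Prop :=
  exists D : set (pformula n),
    [/\ finite_set D,
        forall psi, D psi -> divides A psi
      & forall c, realizes c q -> exists2 psi, D psi & psat c psi].

Definition simple_type (n : nat) (p : set (pformula n)) : Prop :=
  ~ exists (m : nat) (phi : formula L ('I_n + 'I_m)) (k : nat)
       (a : seq nat -> 'I_m -> M),
    [/\ (2 <= k)%N,
        forall f : nat -> nat,
          consistent (p `|` [set PFormula phi (a (mkseq f l)) | l in
                              [set l | (1 <= l)%N]])
      & forall s : seq nat,
          k_inconsistent k (fun j => PFormula phi (a (rcons s j)))].

End Types.

Section Monster.
Variables (L : language) (M : structure L) (K : Type).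

Definition small (X : Type) (A : set X) : Prop := card_lt A [set: K].

Definition saturated : Prop :=
  forall (n : nat) (A : set M) (p : set (pformula M n)),
    small A -> complete_type A p -> exists c, realizes c p.

Definition strongly_homogeneous : Prop :=
  forall (A : set M) (f : M -> M), small A -> elementary_on A f ->
    exists2 g, automorphism g & forall x, A x -> g x = f x.

(* M is a |K|-saturated and strongly |K|-homogeneous model of T, where |K| is
   "sufficiently large": an uncountable strong limit (e.g. a strongly
   inaccessible cardinal) greater than |L|. *)
Definition monster (T : set (sentence L)) : Prop :=
  [/\ models M T,
      uncountable_strong_limit K,
      small [set: fsym L] /\ small [set: rsym L],
      saturated
    & strongly_homogeneous].

Definition type_class (C : forall n, set (set (pformula M n))) : Prop :=
  [/\ forall n p, C n p -> exists2 A : set M, small A & complete_type A p,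
      forall n p (B : set M) q,
        C n p -> small B -> complete_type B q -> p `<=` q -> C n q
    & forall n p f, C n p -> automorphism f -> C n (conj_type f p)].

End Monster.

(* Ord \cup {oo} is [option W] for a well-ordered W, with None = oo.  A rank
   takes set-many ordinal values, so W ranging over all well-orders is the same
   as having Ord as target. *)
Section Ranks.
Variables (d : Order.disp_t) (W : orderType d).

Definition rank_le (a b : option W) : Prop :=
  match a, b with
  | _, None => True
  | None, Some _ => False
  | Some x, Some y => (x <= y)%O
  end.

Variables (L : language) (M : structure L) (K : Type).
Variable C : forall n, set (set (pformula M n)).
Variable R : forall n, set (pformula M n) -> option W.

(* R is only meaningful on C; its values elsewhere are junk. *)
Definition is_rank : Prop :=
  (forall n p q, C (n := n) p -> C q -> p `<=` q -> rank_le (R q) (R p)) /\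
  (forall n p f, C (n := n) p -> automorphism f -> R p = R (conj_type f p)).

Definition ranked (n : nat) (p : set (pformula M n)) : Prop := R p <> None.

Definition bounded_multiplicity : Prop :=
  forall n (A : set M) (p : set (pformula M n)),
    small K A -> complete_type A p -> C p -> ranked p ->
    exists2 kappa : set K, small K kappa &
      forall B : set M, small K B -> A `<=` B ->
        [set q | [/\ complete_type B q, p `<=` q & R q = R p]] #<= kappa.

Definition extension : Prop :=
  forall n (A : set M) (p : set (pformula M n)),
    small K A -> complete_type A p -> C p -> ranked p ->
    forall B : set M, small K B -> A `<=` B ->
      exists q, [/\ complete_type B q, p `<=` q & R p = R q].

Definition reciprocal_forking_rank : Prop :=
  forall n (A B : set M) (p q : set (pformula M n)),
    small K A -> small K B -> complete_type A p -> complete_type B q ->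
    C p -> C q -> p `<=` q -> ranked p -> ~ forks A q -> R q = R p.

End Ranks.

(* Main.v *)
Require Import Defs.
From mathcomp Require Import all_boot all_order all_classical.
From mathcomp Require Import wochoice.

(* First part. Bounded multiplicity makes every ranked type stable: otherwise an
   order property indexed by a linear order with many cuts yields too many
   unstable extensions, each of which keeps the rank by induction on the rank.
   It also makes extensions of the same rank nonforking. For a stable type
   over [A], a nonforking extension over a small model is determined by its
   restriction to the model; hence global nonforking extensions are invariant over
   every small model containing [A], they are the averages of their Morley
   sequences, and any two of them have Morley sequences of the same type over [A].
   So they are conjugate over [A], and one of them has the rank of the original
   type over every small set.

   Second part. A simple type does not fork over its domain, because forking would
   produce trees of dividing formulas of every finite height; so it has
   nonforking extensions over every larger set.

   Global types are represented by ultrafilters on the set of tuples of [M], and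
   the number of parameters is controlled by strong limit cardinals only, since
   [K] may be singular. *)

Set Implicit Arguments.
Unset Strict Implicit.
Unset Printing Implicit Defensive.

Local Open Scope card_scope.
Local Open Scope classical_set_scope.

Local Notation par psi := (@ppar _ _ _ psi).

(** * Small cardinals *)

(** Only one type is stable while the theory is arbitrary, so the tools of stable theories are not
    at hand. Each uniqueness statement is proved by turning its failure into an [order_property] of
    that type. Conjugacy is what transfers the rank. Extension provides one full-rank extension, and
    the given nonforking extension may be a different one; an automorphism over [A] between their
    global types makes the ranks equal. Classically such automorphisms come from definability and
    types over the algebraic closure. Here a Morley sequence over a small model determines its
    global type, so it suffices to move one sequence onto another. This is done term by term, and
    each automorphism also moves the model; invariance over every small model containing [A] absorbs
    that change. Combinatorial arguments see dividing, whereas forking is given. In the first part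
    the passage is made by realizing a type over the parameters of the finitely many dividing
    formulas as well. *)

Lemma card_leTTP (X Y : Type) :
  ([set: X] #<= [set: Y]) <-> exists f : X -> Y, injective f.
Proof.
split=> [/card_leP[f]|[f fI]].
  exists (fun x => val (f (exist _ x (mem_set (I : [set: X] x))))).
  by move=> x y /val_inj /(@inj _ _ _ f) => /(_ (mem_set I) (mem_set I)) [].
have e : f @` [set: X] #= [set: X] by apply: inj_card_eq => x y _ _; apply: fI.
by rewrite -(card_le_eql e); apply: card_leT.
Qed.

Lemma sig_inj (X : Type) (P : X -> Prop) (u v : {x | P x}) :
  proj1_sig u = proj1_sig v -> u = v.
Proof.
case: u v => x px [y py] /= xy; move: px py; rewrite xy => px py.
by rewrite (Prop_irrelevance px py).
Qed.

Lemma card_eq_sig (X : Type) (A : set X) : A #= [set: {x | A x}].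
Proof.
have E : (@proj1_sig X A) @` setT = A.
  apply/seteqP; split=> [_ [[x ax] _ <-] //|x ax].
  by exists (exist _ x ax).
rewrite -[X in X #= _]E; apply: inj_card_eq => u v _ _; exact: sig_inj.
Qed.

Section Small.
Variable K : Type.
Hypothesis hK : uncountable_strong_limit K.

Local Notation smallT X := (small K [set: X]).

Lemma small_le (X Y : Type) (A : set X) (B : set Y) :
  A #<= B -> small K B -> small K A.
Proof.
move=> AB [BK nKB]; split; first exact: card_le_trans AB BK.
by move=> KA; apply: nKB; apply: card_le_trans KA AB.
Qed.

Lemma small_sub (X : Type) (A B : set X) : A `<=` B -> small K B -> small K A.
Proof. by move=> AB; apply: small_le; apply: subset_card_le. Qed.

Lemma small_image (X Y : Type) (f : X -> Y) (A : set X) :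
  small K A -> small K (f @` A).
Proof. by apply: small_le; apply: card_image_le. Qed.

Lemma small_inj (X Y : Type) (f : X -> Y) : injective f -> smallT Y -> smallT X.
Proof. by move=> fI; apply: small_le; apply/card_leTTP; exists f. Qed.

Lemma small_sig (X : Type) (A : set X) : small K A -> smallT {x | A x}.
Proof. by apply: small_le; rewrite (card_le_eqr (card_eq_sig A)) card_lexx. Qed.

Lemma small_range (X Y : Type) (f : X -> Y) : smallT X -> small K (range f).
Proof. exact: small_image. Qed.

Lemma cantor (X : Type) (f : set X -> X) : ~ injective f.
Proof.
move=> fI; pose D := [set x | exists2 A, x = f A & ~ A x].
have [DD|nDD] := pselect (D (f D)).
  by case: (DD) => A /fI <- .
by apply: (nDD); exists D.
Qed.

Lemma small_set (X : Type) : smallT X -> smallT (set X).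
Proof.
move=> sX; have /card_leTTP[f fI] := sX.1.
have sR : card_lt (range f) [set: K] by exact: small_range.
have := hK.2 _ sR; apply: small_le.
have gI : injective (fun A : set X => f @` A).
  move=> A B /= AB; apply/seteqP; split=> x.
    move=> Ax; have : (f @` A) (f x) by exists x.
    by rewrite AB => -[y By /fI <-].
  move=> Ax; have : (f @` B) (f x) by exists x.
  by rewrite -AB => -[y By /fI <-].
have e : (fun A : set X => f @` A) @` setT #= [set: set X].
  by apply: inj_card_eq => A B _ _; apply: gI.
rewrite -(card_le_eql e).
apply: subset_card_le => _ [A _ <-] _ [x _ <-].
by exists x.
Qed.

Lemma small_nat : smallT nat.
Proof. exact: hK.1. Qed.

Lemma small_finset (X : Type) (A : set X) : finite_set A -> small K A.
Proof.
by move=> fA; apply: small_le small_nat; apply: finite_set_countable.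
Qed.

Lemma small_fin (X : finType) : smallT X.
Proof. by apply: small_finset; apply: finite_finset. Qed.

(** Zorn's lemma on graphs of partial injections: a maximal graph missing both some [x] and some [y]
    could be enlarged by the pair [(x, y)]. *)
Lemma inj_total (X Y : Type) :
  (exists f : X -> Y, injective f) \/ (exists f : Y -> X, injective f).
Proof.
pose P (G : set (X * Y)) := (forall x y y', G (x, y) -> G (x, y') -> y = y') /\
  (forall x x' y, G (x, y) -> G (x', y) -> x = x').
have [F FP Ftot|G [[Gf Gi] Gmax]] := @Zorn_bigcup _ P.
  split=> [x y y'|x x' y] [G1 F1 h1] [G2 F2 h2];
    have [le|le] := Ftot _ _ F1 F2; try have [u v] := FP _ F2;
    try have [u' v'] := FP _ F1.
  - by apply: u (le _ h1) h2.
  - by apply: u' h1 (le _ h2).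
  - by apply: v (le _ h1) h2.
  - by apply: v' h1 (le _ h2).
have [hX|/existsNP[x hx]] := pselect (forall x, exists y, G (x, y)).
  left; have [f fG] := choice hX; exists f => x x' e.
  by apply: Gi (fG x) _; rewrite e.
have [hY|/existsNP[y hy]] := pselect (forall y, exists x, G (x, y)).
  right; have [f fG] := choice hY; exists f => y y' e.
  by apply: Gf (fG y) _; rewrite e.
exfalso; apply: (Gmax (G `|` [set (x, y)])).
  split; first by left.
  by move=> /(_ (x, y) (or_intror erefl)) h; apply: hx; exists y.
split=> [x1 y1 y2|x1 x2 y1] [h1|h1] [h2|h2].
- exact: Gf h1 h2.
- by case: h2 => e1 e2; case: hx; exists y1; rewrite -e1.
- by case: h1 => e1 e2; case: hx; exists y2; rewrite -e1.
- by case: h1 h2 => _ -> [_ ->].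
- exact: Gi h1 h2.
- by case: h2 => e1 e2; case: hy; exists x1; rewrite -e2.
- by case: h1 => e1 e2; case: hy; exists x2; rewrite -e2.
- by case: h1 h2 => -> _ [-> _].
Qed.

(** No cardinal arithmetic is used, only closure under power sets: [(x, b)] is coded by the family
    containing the singleton of [x] and, if [b] holds, the empty set. Products and sequences are
    coded by sets in the same spirit. *)
Lemma small_bool_prod (X : Type) : smallT X -> smallT (X * bool).
Proof.
move=> sX; apply: (@small_inj _ _
  (fun u : X * bool => [set Z : set X | Z = [set u.1] \/ (u.2 /\ Z = set0)])
  _ (small_set (small_set sX))).
move=> [x b] [y c] /= e.
have E Z : (Z = [set x] \/ b /\ Z = set0) = (Z = [set y] \/ c /\ Z = set0).
  exact: (congr1 (fun P : set (set X) => P Z) e).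
have n0 z : [set z] = set0 :> set X -> False.
  by move=> h; have : (set0 : set X) z by rewrite -h.
have xy : x = y.
  have : [set x] = [set y] \/ c /\ [set x] = set0 by rewrite -E; left.
  case=> [h|[_ /n0 //]]; have : [set y] x by rewrite -h.
  by [].
rewrite xy; congr pair; apply/idP/idP => h.
  have : set0 = [set y] \/ c /\ set0 = set0 :> set X by rewrite -E; right.
  by case=> [/esym/n0|[]].
have : set0 = [set x] \/ b /\ set0 = set0 :> set X by rewrite E; right.
by case=> [/esym/n0|[]].
Qed.

Lemma small_sum (X Y : Type) : smallT X -> smallT Y -> smallT (X + Y).
Proof.
move=> sX sY; have [[f fI]|[f fI]] := inj_total X Y.
  apply: (@small_inj _ _
    (fun u : X + Y => match u with inl x => (f x, true) | inr y => (y, false) end)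
    _ (small_bool_prod sY)).
  by move=> [x|y] [x'|y'] //= [] => [/fI ->|->].
apply: (@small_inj _ _
  (fun u : X + Y => match u with inl x => (x, true) | inr y => (f y, false) end)
  _ (small_bool_prod sX)).
by move=> [x|y] [x'|y'] //= [] => [->|/fI ->].
Qed.

Lemma small_prod (X Y : Type) : smallT X -> smallT Y -> smallT (X * Y).
Proof.
move=> sX sY; apply: (@small_inj _ _
  (fun u : X * Y => [set z : X + Y | z = inl u.1 \/ z = inr u.2])
  _ (small_set (small_sum sX sY))).
move=> [x y] [x' y'] /= e.
have E z : (z = inl x \/ z = inr y) = (z = inl x' \/ z = inr y').
  exact: (congr1 (fun P : set (X + Y) => P z) e).
have : (inl x : X + Y) = inl x' \/ (inl x : X + Y) = inr y' by rewrite -E; left.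
have : (inr y : X + Y) = inl x' \/ (inr y : X + Y) = inr y' by rewrite -E; right.
by case=> // -[->] [] // -[->].
Qed.

Lemma small_seq (X : Type) : smallT X -> smallT (seq X).
Proof.
move=> sX; apply: (@small_inj _ _
  (fun s : seq X => [set u : nat * X | onth s u.1 = Some u.2])
  _ (small_set (small_prod small_nat sX))).
elim=> [|x s IH] [|y t] //= e.
- have := congr1 (fun P : set (nat * X) => P (0, y)) e => /= E.
  by have : onth [::] 0 = Some y by rewrite E.
- have := congr1 (fun P : set (nat * X) => P (0, x)) e => /= E.
  by have : onth [::] 0 = Some x by rewrite -E.
have E i z : (onth (x :: s) i = Some z) = (onth (y :: t) i = Some z).
  exact: (congr1 (fun P : set (nat * X) => P (i, z)) e).
have : onth (y :: t) 0 = Some x by rewrite -E.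
move=> [->]; congr cons; apply: IH; apply/seteqP; split=> -[i z] /= h.
  by have : onth (y :: t) i.+1 = Some z by rewrite -E.
by have : onth (x :: s) i.+1 = Some z by rewrite E.
Qed.

Lemma small_tree (X : Type) : smallT X -> smallT (GenTree.tree X).
Proof.
move=> sX; apply: (@small_inj _ _ (@GenTree.encode X) _ (small_seq (small_sum small_nat sX))).
exact: pcan_inj (@GenTree.codeK X).
Qed.

Lemma small_setU (X : Type) (A B : set X) : small K A -> small K B -> small K (A `|` B).
Proof.
move=> sA sB; have s := small_sum (small_sig sA) (small_sig sB).
apply: small_sub (small_range
  (fun u : {x | A x} + {x | B x} =>
     match u with inl u => proj1_sig u | inr u => proj1_sig u end) s).
move=> x [ax|bx]; first by exists (inl (exist _ x ax)).
by exists (inr (exist _ x bx)).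
Qed.

End Small.

Notation smallT K X := (small K [set: X]).

(** * Linear orders, and tuples indexed by sums *)

Lemma linear_order (T : Type) : exists lt : T -> T -> Prop,
  [/\ forall x, ~ lt x x, forall x y z, lt x y -> lt y z -> lt x z
    & forall x y, x <> y -> lt x y \/ lt y x].
Proof.
have [R Rwo] := @well_ordering_principle {classic T}.
have Rw : wo_chain R predT by move=> A _; apply: Rwo.
have Ra : forall x y, R x y -> R y x -> x = y.
  by move=> x y xy yx; apply: (wo_chain_antisymmetric Rw) => //; rewrite xy yx.
have Rt : forall x y, R x y \/ R y x.
  by move=> x y; have := @wo_chainW {classic T} R predT Rw x y isT isT => /orP.
exists (fun x y => R x y /\ x <> y); split.
- by move=> x [].
- move=> x y z [xy nxy] [yz nyz]; split; last first.
    by move=> xz; apply: nxy; apply: Ra => //; rewrite xz.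
  have [//|zx] := Rt x z.
  (* Transitivity is read off the least of the three elements: if it is [x], the goal holds; [y] or
     [z] would contradict antisymmetry. *)
  have [m [[mS mlb] _]] := Rwo [pred u | `[< [\/ u = x, u = y | u = z] >]]
    (ex_intro _ (x : {classic T}) (asboolT (Or31 _ _ erefl))).
  have hx := mlb x (asboolT (Or31 _ _ erefl)).
  have hy := mlb y (asboolT (Or32 _ _ erefl)).
  have hz := mlb z (asboolT (Or33 _ _ erefl)).
  move: mS => /asboolP[] e; rewrite {}e in hx hy hz => //.
    by case: nxy; apply: Ra.
  by case: nyz; apply: Ra.
- move=> x y nxy; have [h|h] := Rt x y; [left|right]; split => //.
  by move=> e; apply: nxy.
Qed.

Definition jn (V W T : Type) (a : V -> T) (b : W -> T) (u : V + W) : T :=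
  match u with inl x => a x | inr y => b y end.

Lemma comp_jn (V W T U : Type) (g : T -> U) (a : V -> T) (b : W -> T) :
  g \o jn a b = jn (g \o a) (g \o b).
Proof. by apply: funext => -[]. Qed.

Definition smap (V W V' W' : Type) (f : V -> V') (g : W -> W') : V + W -> V' + W' :=
  jn (inl \o f) (inr \o g).

Lemma jn_smap (V W V' W' T : Type) (f : V -> V') (g : W -> W') (a : V' -> T) (b : W' -> T) :
  jn a b \o smap f g = jn (a \o f) (b \o g).
Proof. by apply: funext => -[]. Qed.

(** * Formulas *)

Section Formulas.
Variable L : language.

Fixpoint tren (V W : Type) (f : V -> W) (t : term L V) : term L W :=
  match t with
  | tVar x => tVar L (f x)
  | tApp g ts => tApp (fun i => tren f (ts i))
  end.

Fixpoint ren (V : Type) (phi : formula L V) : forall W, (V -> W) -> formula L W :=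
  match phi with
  | fEq t u => fun W f => fEq (tren f t) (tren f u)
  | fRel r ts => fun W f => fRel (fun i => tren f (ts i))
  | fNot psi => fun W f => fNot (ren psi f)
  | fAnd psi chi => fun W f => fAnd (ren psi f) (ren chi f)
  | fEx psi => fun W f => fEx (ren psi (option_map f))
  end.

Variable M : structure L.

Lemma teval_ren (V W : Type) (f : V -> W) (v : W -> M) (t : term L V) :
  teval v (tren f t) = teval (v \o f) t.
Proof. by elim: t => //= g ts IH; congr finterp; apply: funext. Qed.

Lemma sat_ren (V : Type) (phi : formula L V) (W : Type) (f : V -> W) (v : W -> M) :
  sat (ren phi f) v = sat phi (v \o f).
Proof.
elim: phi W f v => {V} [V t u|V r ts|V psi IH|V psi IH chi IH'|V psi IH] W f v /=.
- by rewrite !teval_ren.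
- by congr rinterp; apply: funext => i; rewrite teval_ren.
- by rewrite IH.
- by rewrite IH IH'.
- congr ex; apply: funext => b; rewrite IH; congr (sat psi).
  by apply: funext => -[].
Qed.

Lemma teval_support (V : Type) (t : term L V) : exists2 F : set V, finite_set F &
  forall v v' : V -> M, (forall x, F x -> v x = v' x) -> teval v t = teval v' t.
Proof.
elim: t => [x|g ts IH].
  by exists [set x] => // v v' e /=; apply: e.
have /choice[F FP] : forall i, exists F : set V, finite_set F /\
    forall v v' : V -> M, (forall x, F x -> v x = v' x) -> teval v (ts i) = teval v' (ts i).
  by move=> i; have [F] := IH i; exists F.
exists (\bigcup_(i in setT) F i).
  by apply: bigcup_finite => [|i _]; [exact: finite_finset|case: (FP i)].
move=> v v' e /=; congr finterp; apply: funext => i.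
by apply: (FP i).2 => x Fx; apply: e; exists i.
Qed.

Lemma sat_support (V : Type) (phi : formula L V) : exists2 F : set V, finite_set F &
  forall v v' : V -> M, (forall x, F x -> v x = v' x) -> sat phi v = sat phi v'.
Proof.
elim: phi => {V} [V t u|V r ts|V psi [F Ff FP]|V psi [F Ff FP] chi [G Gf GP]|V psi [F Ff FP]].
- have [F Ff FP] := teval_support t; have [G Gf GP] := teval_support u.
  exists (F `|` G) => [|v v' e /=]; first by rewrite finite_setU.
  by rewrite (FP v v') ?(GP v v') // => x Fx; apply: e; [right|left].
- have /choice[F FP] : forall i, exists F : set V, finite_set F /\
      forall v v' : V -> M, (forall x, F x -> v x = v' x) -> teval v (ts i) = teval v' (ts i).
    by move=> i; have [F] := teval_support (ts i); exists F.
  exists (\bigcup_(i in setT) F i).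
    by apply: bigcup_finite => [|i _]; [exact: finite_finset|case: (FP i)].
  move=> v v' e /=; congr rinterp; apply: funext => i.
  by apply: (FP i).2 => x Fx; apply: e; exists i.
- by exists F => // v v' e /=; rewrite (FP v v').
- exists (F `|` G) => [|v v' e /=]; first by rewrite finite_setU.
  by rewrite (FP v v') ?(GP v v') // => x Fx; apply: e; [right|left].
- exists (Some @^-1` F).
    by apply: (finite_preimage _ Ff) => x y _ _ [].
  move=> v v' e /=; congr ex; apply: funext => b; apply: FP => -[x|] //= Fx.
  exact: e.
Qed.

Lemma finite_parameters (V W : Type) (phi : formula L (V + W)) :
  exists m (s : 'I_m -> W) (psi : formula L (V + 'I_m)),
    forall (a : V -> M) (b : W -> M), sat phi (jn a b) = sat psi (jn a (b \o s)).
Proof.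
have [[w0 _]|nW] := pselect (exists w : W, True); last first.
  have f : W -> 'I_0 by move=> w; exfalso; apply: nW; exists w.
  exists 0, (fun i : 'I_0 => match notF (ltn_ord i) with end), (ren phi (smap id f)) => a b.
  rewrite sat_ren jn_smap; congr (sat phi); congr jn.
  by apply: funext => w; exfalso; apply: nW; exists w.
have [F Ff FP] := sat_support phi.
have : finite_set (inr @^-1` F : set {classic W}).
  by apply: (finite_preimage _ Ff) => x y _ _ [].
move=> /finite_seqP[l lE].
(* One index more than the length of [l] keeps the index type inhabited, as [inord] requires; the
   extra entry is the default [w0]. *)
pose s (i : 'I_(size l).+1) : W := nth (w0 : {classic W}) l i.
pose f (w : W) : 'I_(size l).+1 := inord (index (w : {classic W}) l).
exists (size l).+1, s, (ren phi (smap id f)) => a b.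
rewrite sat_ren jn_smap; apply: FP => -[//|w] Fw /=; rewrite /s /f; congr b.
have wl : (w : {classic W}) \in l.
  have : (inr @^-1` F : set {classic W}) w by [].
  by rewrite lE.
by rewrite inordK ?nth_index // ltnS index_size.
Qed.

Lemma exists_tuple (n : nat) (V : Type) (phi : formula L ('I_n + V)) :
  exists psi : formula L V, forall v : V -> M,
    sat psi v = exists x : 'I_n -> M, sat phi (jn x v).
Proof.
elim: n V phi => [|n IH] V phi.
  pose g (u : 'I_0 + V) : V :=
    match u with inl i => match notF (ltn_ord i) with end | inr v => v end.
  exists (ren phi g) => v; rewrite sat_ren.
  have e (x : 'I_0 -> M) : jn x v = v \o g.
    by apply: funext => -[[]|].
  apply/propext; split=> [h|[x]]; last by rewrite e.
  by exists (fun i : 'I_0 => match notF (ltn_ord i) with end); rewrite e.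
pose g (u : 'I_n.+1 + V) : 'I_n + option V :=
  match u with
  | inl i => if unlift ord0 i is Some j then inl j else inr None
  | inr v => inr (Some v)
  end.
have [psi psiP] := IH _ (ren phi g); exists (fEx psi) => v /=.
apply/propext; split=> [[b]|[x h]].
  rewrite psiP => -[x]; rewrite sat_ren => h.
  exists (fun i => if unlift ord0 i is Some j then x j else b).
  apply: (eq_ind _ (sat phi) h); apply: funext => -[i|w] //=.
  by case: unlift.
exists (x ord0); rewrite psiP; exists (fun j => x (lift ord0 j)); rewrite sat_ren.
apply: (eq_ind _ (sat phi) h); apply: funext => -[i|w] //=.
by case: unliftP => [j|] ->.
Qed.

Definition ftrue (V : Type) : formula L V := fEx (fEq (tVar L None) (tVar L None)).

Lemma sat_true (V : Type) (v : V -> M) : sat (ftrue V) v.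
Proof. by have [x] := carrier_inhabited M; exists x. Qed.

Lemma forall_index (k : nat) (V : Type) (phi : 'I_k -> formula L V) :
  exists psi : formula L V, forall v : V -> M,
    sat psi v = forall i, sat (phi i) v.
Proof.
elim: k phi => [|k IH] phi.
  exists (ftrue V) => v; apply/propext; split=> [_ []//|_]; exact: sat_true.
have [psi psiP] := IH (fun j => phi (lift ord0 j)).
exists (fAnd (phi ord0) psi) => v /=; rewrite psiP.
apply/propext; split=> [[h0 h] i|h]; last by split.
by case: (unliftP ord0 i) => [j|] ->.
Qed.

(** * Parameters, types and automorphisms *)

(** Every element of [E] serves as a variable interpreted by itself. No finite parameter tuple has
    to be chosen until [pformula_of_formula] returns to formulas of type [pformula]. *)
Definition vl (E : set M) : {x | E x} -> M := @proj1_sig M E.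

Lemma sat_parameters (E : set M) (V W : Type) (e : W -> M) (phi : formula L (V + W)) :
  (forall w, E (e w)) ->
  exists psi : formula L (V + {x | E x}),
    forall a : V -> M, sat phi (jn a e) = sat psi (jn a (@vl E)).
Proof.
move=> Ee; exists (ren phi (smap id (fun w => exist _ (e w) (Ee w)))) => a.
by rewrite sat_ren jn_smap.
Qed.

Lemma formula_of_pformula (E : set M) (n : nat) (psi : pformula M n) : Defs.over E psi ->
  exists phi : formula L ('I_n + {x | E x}),
    forall c, psat c psi = sat phi (jn c (@vl E)).
Proof.
by move=> o; have [phi phiP] := sat_parameters (pfml psi) o; exists phi => c; rewrite -phiP.
Qed.

Lemma pformula_of_formula (E : set M) (n : nat) (phi : formula L ('I_n + {x | E x})) :
  exists2 psi : pformula M n, Defs.over E psi &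
    forall c, psat c psi = sat phi (jn c (@vl E)).
Proof.
have [m [s [psi psiP]]] := finite_parameters phi.
by exists (PFormula psi (@vl E \o s)) => [j|c]; [exact: proj2_sig|rewrite psiP].
Qed.

(** Equality of types over [E], for tuples of any index type, possibly infinite, whereas [tp] covers
    finite tuples. It is stated by equality of propositions so that it rewrites. *)
Definition eqv (E : set M) (V : Type) (a b : V -> M) : Prop :=
  forall phi : formula L (V + {x | E x}), sat phi (jn a (@vl E)) = sat phi (jn b (@vl E)).

Lemma eqv_imp (E : set M) (V : Type) (a b : V -> M) :
  (forall phi : formula L (V + {x | E x}),
     sat phi (jn a (@vl E)) -> sat phi (jn b (@vl E))) -> eqv E a b.
Proof.
move=> h phi; apply/propext; split; first exact: h.
by move=> hb; apply: contrapT => ha; apply: (h (fNot phi)) hb.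
Qed.

Lemma eqv_refl (E : set M) (V : Type) (a : V -> M) : eqv E a a.
Proof. by []. Qed.

Lemma eqv_sym (E : set M) (V : Type) (a b : V -> M) : eqv E a b -> eqv E b a.
Proof. by move=> h phi. Qed.

Lemma eqv_trans (E : set M) (V : Type) (b a c : V -> M) :
  eqv E a b -> eqv E b c -> eqv E a c.
Proof. by move=> h h' phi; rewrite h. Qed.

Lemma eqv_sat (E : set M) (V W : Type) (a b : V -> M) (e : W -> M) :
  eqv E a b -> (forall w, E (e w)) ->
  forall phi : formula L (V + W), sat phi (jn a e) = sat phi (jn b e).
Proof. by move=> h Ee phi; have [psi psiP] := sat_parameters phi Ee; rewrite !psiP. Qed.

Lemma eqv_sub (E F : set M) (V : Type) (a b : V -> M) :
  F `<=` E -> eqv E a b -> eqv F a b.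
Proof. by move=> FE h phi; apply: (eqv_sat h) => -[x Fx]; apply: FE. Qed.

Lemma eqv_comp (E : set M) (U V : Type) (f : U -> V) (a b : V -> M) :
  eqv E a b -> eqv E (a \o f) (b \o f).
Proof.
move=> h phi; have := h (ren phi (smap f id)).
by rewrite !sat_ren !jn_smap.
Qed.

Lemma eqv_jn (E : set M) (V W : Type) (a b : V -> M) (e : W -> M) :
  eqv E a b -> (forall w, E (e w)) -> eqv E (jn a e) (jn b e).
Proof.
move=> h Ee phi.
pose g (u : (V + W) + {x | E x}) : V + {x | E x} :=
  match u with
  | inl (inl v) => inl v
  | inl (inr w) => inr (exist _ (e w) (Ee w))
  | inr p => inr p
  end.
have eq c : jn (jn c e) (@vl E) = jn c (@vl E) \o g.
  by apply: funext => -[[]|].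
by rewrite !eq -!sat_ren.
Qed.

Lemma tp_eqv (E : set M) (n : nat) (c d : 'I_n -> M) : tp E c = tp E d <-> eqv E c d.
Proof.
split=> [e|h].
  apply: eqv_imp => phi; have [psi o psiP] := pformula_of_formula phi.
  rewrite -!psiP => h; have : tp E c psi by exact: (conj o h).
  by rewrite e => -[].
apply/seteqP; split=> psi [o hp]; split=> //; move: hp;
  have [phi phiP] := formula_of_pformula o; by rewrite !phiP h.
Qed.

Lemma teval_aut (g : M -> M) : automorphism g -> forall V (v : V -> M) t,
  g (teval v t) = teval (g \o v) t.
Proof.
move=> [_ gf _] V v; elim=> //= f ts IH; rewrite gf; congr finterp.
by apply: funext => i /=; rewrite IH.
Qed.

Lemma sat_aut (g : M -> M) : automorphism g -> forall V (phi : formula L V) v,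
  sat phi (g \o v) = sat phi v.
Proof.
move=> ag; have [[h hg gh] gf gr] := ag; move=> V.
elim=> {V} [V t u|V r ts|V psi IH|V psi IH chi IH'
  |V psi IH] v /=.
- rewrite -!teval_aut //; apply/propext; split=> [/(can_inj hg)|->] //.
- transitivity (rinterp (g \o (fun i => teval v (ts i)))).
    by congr rinterp; apply: funext => i /=; rewrite teval_aut.
  by apply/propext; split=> [h'|/gr //]; apply/gr.
- by rewrite IH.
- by rewrite IH IH'.
- apply/propext; split=> -[b].
    have -> : oapp (g \o v) b = g \o oapp v (h b).
      by apply: funext => -[x|] //=; rewrite gh.
    by rewrite IH => hb; exists (h b).
  rewrite -IH => hb; exists (g b).
  by have -> : oapp (g \o v) (g b) = g \o oapp v b by apply: funext => -[].
Qed.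

Lemma aut_inv (g : M -> M) : automorphism g ->
  exists h, [/\ automorphism h, cancel g h & cancel h g].
Proof.
move=> [[h hg gh] gf gr]; exists h; split=> //; split.
- by exists g.
- move=> f v; apply: (can_inj hg); rewrite gh gf; congr finterp.
  by apply: funext => i /=; rewrite gh.
- move=> r v; have e : v = g \o (h \o v) by apply: funext => i /=; rewrite gh.
  by have := gr r (h \o v); rewrite -e => -[h1 h2]; split.
Qed.

Lemma aut_comp (f g : M -> M) : automorphism f -> automorphism g -> automorphism (f \o g).
Proof.
move=> [bf ff fr] [bg gf gr]; split.
- exact: bij_comp.
- by move=> k v /=; rewrite gf ff.
- by move=> r v; rewrite gr fr.
Qed.

Definition aut_over (E : set M) (g : M -> M) : Prop :=
  automorphism g /\ forall x, E x -> g x = x.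

Lemma aut_over_inv (E : set M) (g : M -> M) : aut_over E g ->
  exists h, [/\ aut_over E h, cancel g h & cancel h g].
Proof.
move=> [ag gE]; have [h [ah gh hg]] := aut_inv ag; exists h; split=> //.
by split=> // x Ex; rewrite -{1}(gE x Ex).
Qed.

Lemma aut_over_comp (E : set M) (f g : M -> M) :
  aut_over E f -> aut_over E g -> aut_over E (f \o g).
Proof.
move=> [af fE] [ag gE]; split; first exact: aut_comp.
by move=> x Ex /=; rewrite gE ?fE.
Qed.

Lemma aut_over_sub (E F : set M) (g : M -> M) : F `<=` E -> aut_over E g -> aut_over F g.
Proof. by move=> FE [ag gE]; split=> // x /FE /gE. Qed.

Lemma aut_eqv (E : set M) (g : M -> M) (V : Type) (a : V -> M) :
  aut_over E g -> eqv E (g \o a) a.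
Proof.
move=> [ag gE] phi; rewrite -[RHS](sat_aut ag); congr (sat phi).
rewrite comp_jn; congr jn; apply: funext => -[x Ex] /=; by rewrite gE.
Qed.

Section Homogeneous.
Variable K : Type.
Hypothesis hK : uncountable_strong_limit K.
Hypothesis hM : strongly_homogeneous M K.

(** The map fixing [E] and sending [a v] to [b v] is well defined because equalities between entries
    belong to the common type. Elsewhere it is the identity, where strong homogeneity asks
    nothing. *)
Lemma homogeneous (E : set M) (V : Type) (a b : V -> M) :
  small K E -> smallT K V -> eqv E a b ->
  exists2 g, aut_over E g & g \o a = b.
Proof.
move=> sE sV h.
have eqP (t u : V + {x | E x}) : jn a (@vl E) t = jn a (@vl E) u ->
    jn b (@vl E) t = jn b (@vl E) u.
  by move=> e; have := h (fEq (tVar L t) (tVar L u)) => /= <-.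
have /choice[f fP] : forall x, exists y, forall t, jn a (@vl E) t = x -> y = jn b (@vl E) t.
  move=> x; have [[t tx]|nt] := pselect (exists t, jn a (@vl E) t = x).
    by exists (jn b (@vl E) t) => u ux; apply: eqP; rewrite tx ux.
  by exists x => t tx; case: nt; exists t.
have [||g ag gf] := hM (A := E `|` range a) (f := f).
- by apply: small_setU => //; apply: small_range.
- move=> m phi u uA.
  have /choice[t tP] : forall j, exists t : V + {x | E x}, jn a (@vl E) t = u j.
    move=> j; have [Ex|[v _ va]] := uA j; last by exists (inl v).
    by exists (inr (exist _ _ Ex)).
  have -> : u = jn a (@vl E) \o t by apply: funext => j /=; rewrite tP.
  have -> : f \o (jn a (@vl E) \o t) = jn b (@vl E) \o t.
    by apply: funext => j /=; apply: fP.
  by rewrite -!sat_ren h.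
exists g; first split=> // x Ex.
  by rewrite gf; [rewrite (fP x (inr (exist _ x Ex)))|left].
apply: funext => v /=; rewrite gf; last by right; exists v.
by rewrite (fP _ (inl v)).
Qed.

End Homogeneous.
End Formulas.

(** * Saturation *)

Section Ultrafilters.
Variables (T : Type) (U : set_system T).
Hypothesis uU : UltraFilter U.

Lemma ultra_setC (A : set T) : U (~` A) = ~ U A.
Proof.
apply/propext; split=> [nA hA|nA].
  by have [x []] := filter_ex (filterI hA nA).
by have [] := @in_ultra_setVsetC _ _ A uU.
Qed.

Lemma ultra_cst (P : Prop) : U [set _ | P] = P.
Proof.
apply/propext; split=> [h|p]; first by have [] := filter_ex h.
by apply: filterS (@filterT _ U _).
Qed.

Lemma ultra_forall_finite (I : Type) (F : set I) (S : I -> set T) :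
  finite_set F -> (forall i, F i -> U (S i)) -> U [set x | forall i, F i -> S i x].
Proof.
move=> Ff; have /finite_seqP[s sE] : finite_set (F : set {classic I}) by [].
have sP i : F i <-> (i : {classic I}) \in s.
  have e : F i = ((i : {classic I}) \in s) :> Prop :=
    congr1 (fun A : set {classic I} => A i) sE.
  by rewrite e.
move=> h; have {h} : forall i, (i : {classic I}) \in s -> U (S i) by move=> i /sP /h.
have -> : [set x | forall i, F i -> S i x] =
    [set x | forall i, (i : {classic I}) \in s -> S i x].
  by apply/seteqP; split=> x h i /sP; apply: h.
elim: (s) => [|i l IH] h; first by apply: filterS (@filterT _ U _).
have hi := h i (mem_head _ _).
have hl : U [set x | forall j, (j : {classic I}) \in l -> S j x].
  by apply: IH => j jl; apply: h; rewrite in_cons jl orbT.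
apply: filterS (filterI hi hl) => x [xi xl] j.
by rewrite in_cons => /orP[/eqP -> //|]; apply: xl.
Qed.

End Ultrafilters.

Section Saturation.
Variables (L : language) (M : structure L) (K : Type).
Hypothesis hK : uncountable_strong_limit K.
Hypothesis hS : saturated M K.

(** [saturated] concerns finite tuples; the property is isolated for each index type [V] because
    infinite tuples need a separate argument. *)
Definition ultra_realized (V : Type) : Prop :=
  forall U : set_system (V -> M), UltraFilter U -> forall E : set M, small K E ->
  exists c : V -> M, forall phi : formula L (V + {x | E x}),
    sat phi (jn c (@vl L M E)) = U [set v | sat phi (jn v (@vl L M E))].

Lemma ultra_realized_fin (n : nat) : ultra_realized 'I_n.
Proof.
move=> U uU E sE.
pose p : set (pformula M n) := [set psi | Defs.over E psi /\ U [set v | psat v psi]].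
have [|c cP] := hS (p := p) sE.
  split.
  - by move=> psi [].
  - move=> F Ff Fp; have : U [set v | forall psi, F psi -> psat v psi].
      by apply: ultra_forall_finite => // psi /Fp [].
    by move=> /filter_ex[c cF]; exists c.
  - move=> psi o; have [h|h] := pselect (U [set v | psat v psi]); first by left.
    by right; split=> //; rewrite -ultra_setC in h.
have h (phi : formula L ('I_n + {x | E x})) : U [set v | sat phi (jn v (@vl _ _ E))] ->
    sat phi (jn c (@vl _ _ E)).
  have [psi o psiP] := pformula_of_formula phi; rewrite -psiP => h.
  apply: cP; split=> //; apply: filterS h => v /=; by rewrite psiP.
exists c => phi; apply/propext; split=> [hc|/h //].
apply: contrapT; rewrite -ultra_setC => hn.
exact: (h (fNot phi)).
Qed.

(** Compactness in the form used below: the sets [S i] are stages of an approximation and may be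
    undefinable. An ultrafilter containing all of them is realized, so a first-order property that
    holds throughout one stage passes to the limit. *)
Lemma directed_realized (V : Type) : ultra_realized V ->
  forall (E : set M) (I : Type) (i0 : I) (S : I -> set (V -> M)), small K E ->
  (forall i, S i !=set0) ->
  (forall i j, exists k, S k `<=` S i `&` S j) ->
  exists c : V -> M, forall phi : formula L (V + {x | E x}),
    (exists i, forall v, S i v -> sat phi (jn v (@vl L M E))) -> sat phi (jn c (@vl L M E)).
Proof.
move=> hV E I i0 S sE S0 Sd.
have PF : ProperFilter (filter_from setT S).
  apply: filter_from_proper => [|i _]; last exact: S0.
  apply: filter_from_filter; first by exists i0.
  by move=> i j _ _; have [k] := Sd i j; exists k.
have [U [uU SU]] := ultraFilterLemma PF.
have [c cP] := hV U uU E sE; exists c => phi [i Si]; rewrite cP.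
by apply: SU; exists i.
Qed.

Section Infinite.
Variables (V : Type) (U : set_system (V -> M)) (E : set M).
Hypothesis uU : UltraFilter U.
Hypothesis sE : small K E.
Hypothesis sV : smallT K V.

(* Zorn's lemma on partial realizations of [U], given by their graphs. *)
Let good (G : set (V * M)) : Prop :=
  forall phi : formula L ({p | G p} + {x | E x}),
    sat phi (jn (fun p => (proj1_sig p).2) (@vl L M E)) =
    U [set v | sat phi (jn (fun p => v (proj1_sig p).1) (@vl L M E))].

Let good_imp (G : set (V * M)) :
  (forall phi : formula L ({p | G p} + {x | E x}),
     U [set v | sat phi (jn (fun p => v (proj1_sig p).1) (@vl L M E))] ->
     sat phi (jn (fun p => (proj1_sig p).2) (@vl L M E))) -> good G.
Proof.
move=> h phi; apply/propext; split=> [hc|/h //].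
apply: contrapT; rewrite -ultra_setC => hn.
exact: (h (fNot phi)).
Qed.

Let good_chain (F : set (set (V * M))) :
  F `<=` good -> total_on F subset -> good (\bigcup_(G in F) G).
Proof.
move=> Fg Ft; apply: good_imp => phi.
pose swp (u : {p | (\bigcup_(G in F) G) p} + {x | E x}) :
    {x | E x} + {p | (\bigcup_(G in F) G) p} :=
  match u with inl p => inr p | inr q => inl q end.
have [m [s [psi psiP]]] := finite_parameters M (ren phi swp).
have psiE b : sat phi (jn b (@vl _ _ E)) = sat psi (jn (@vl _ _ E) (b \o s)).
  by rewrite -psiP sat_ren; congr (sat phi); apply: funext => -[].
rewrite psiE; have [G [gG Gs]] : exists G, good G /\ forall i, G (proj1_sig (s i)).
  (* The empty chain is separate: no coordinate occurs, so truth does not depend on the point and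
     [ultra_cst] applies. *)
  have [[G0 FG0]|nF] := pselect (F !=set0); last first.
    have m0 : 'I_m -> False.
      by move=> j; have [_ [G FG _]] := s j; apply: nF; exists G.
    exists set0; split=> [|i]; last by case: (m0 i).
    apply: good_imp => chi.
    have e v : jn (fun p : {p | set0 p} => v (proj1_sig p).1) (@vl L M E) =
        jn (fun p : {p | set0 p} => (proj1_sig p).2) (@vl L M E).
      by apply: funext => -[[? []]|].
    by under eq_set do rewrite e; rewrite ultra_cst.
  suff [G FG Gs] : exists2 G, F G & forall i, G (proj1_sig (s i)).
    by exists G; split=> //; apply: Fg.
  elim: (m) (s) => [|k IH] t; first by exists G0 => // -[].
  have [G FG Gt] := IH (fun j => t (lift ord0 j)).
  have [H FH Ht] := proj2_sig (t ord0).
  have [le|le] := Ft _ _ FG FH.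
    by exists H => // i; case: (unliftP ord0 i) => [j|] -> //; apply: le.
  by exists G => // i; case: (unliftP ord0 i) => [j|] -> //; apply: le.
pose g (u : {x | E x} + 'I_m) : {p | G p} + {x | E x} :=
  match u with inl x => inr x | inr i => inl (exist _ (proj1_sig (s i)) (Gs i)) end.
have := gG (ren psi g); rewrite sat_ren.
have e b : jn b (@vl _ _ E) \o g =
    jn (@vl _ _ E) (fun i => b (exist _ (proj1_sig (s i)) (Gs i))).
  by apply: funext => -[].
rewrite e => ->; apply: filterS => v /=; rewrite psiE sat_ren e.
by [].
Qed.

Let good_functional (G : set (V * M)) v x y : good G -> G (v, x) -> G (v, y) -> x = y.
Proof.
move=> gG h1 h2.
have := gG (fEq (tVar L (inl (exist G _ h1))) (tVar L (inl (exist G _ h2)))) => /= ->.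
by apply: filterS (@filterT _ U _).
Qed.

(** The new value realizes the formulas that hold at coordinate [v] almost everywhere. Each is
    satisfiable at the values already chosen, because goodness of [G] applies to [fEx phi]. Those
    values form a small set: distinct values come from distinct coordinates, as [G] is
    functional. *)
Let good_extend (G : set (V * M)) v : good G -> (forall x, ~ G (v, x)) ->
  exists x, good (G `|` [set (v, x)]).
Proof.
move=> gG nG; pose E' := E `|` (snd @` G).
have sE' : small K E'.
  apply: small_setU => //.
  suff : smallT K {y | (snd @` G) y}.
    by apply: small_le; rewrite (card_le_eql (card_eq_sig _)) card_lexx.
  have /choice[f fP] : forall y : {y | (snd @` G) y}, exists v, G (v, proj1_sig y).
    by move=> [y hy] /=; case: hy => -[w z] Gz <-; exists w.
  apply: (small_inj (f := f)) sV => y z yz; apply: sig_inj.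
  by apply: good_functional gG (fP y) _; rewrite yz.
pose e (w : V -> M) := jn (fun p : {p | G p} => w (proj1_sig p).1) (@vl L M E).
pose e0 := jn (fun p : {p | G p} => (proj1_sig p).2) (@vl L M E).
pose I := {phi : formula L (option ({p | G p} + {x | E x})) |
  U [set w | sat phi (oapp (e w) (w v))]}.
pose S (i : I) := [set x : 'I_1 -> M | sat (proj1_sig i) (oapp e0 (x ord0))].
have i0 : I.
  exists (ftrue L _); apply: filterS (@filterT _ U _) => w _; exact: sat_true.
have [||c cP] := @directed_realized _ (@ultra_realized_fin 1) E' I i0 S sE'.
- move=> [phi Uphi].
  have : sat (fEx phi) e0.
    rewrite /e0 (gG (fEx phi)); apply: filterS Uphi => w h /=.
    by exists (w v).
  by move=> [b hb]; exists (fun=> b).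
- move=> [phi Uphi] [psi Upsi].
  have Uand : U [set w | sat (fAnd phi psi) (oapp (e w) (w v))].
    by apply: filterS (filterI Uphi Upsi).
  by exists (exist _ (fAnd phi psi) Uand) => x [].
exists (c ord0); apply: good_imp => phi.
have /choice[f fP] : forall u : {p | (G `|` [set (v, c ord0)]) p} + {x | E x},
    exists t : option ({p | G p} + {x | E x}),
    (forall w, jn (fun p => w (proj1_sig p).1) (@vl L M E) u = oapp (e w) (w v) t) /\
    jn (fun p => (proj1_sig p).2) (@vl L M E) u = oapp e0 (c ord0) t.
  move=> [[p hp]|q]; last by exists (Some (inr q)).
  have [Gp|nGp] := pselect (G p); first by exists (Some (inl (exist _ p Gp))).
  have pe : p = (v, c ord0) by case: (hp).
  by exists None; split=> [w|] /=; rewrite pe.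
have e1 w : jn (fun p => w (proj1_sig p).1) (@vl L M E) = oapp (e w) (w v) \o f.
  by apply: funext => u; rewrite (fP u).1.
have -> : jn (fun p => (proj1_sig p).2) (@vl L M E) = oapp e0 (c ord0) \o f.
  by apply: funext => u; rewrite (fP u).2.
rewrite -sat_ren => Uphi.
have Uphi' : U [set w | sat (ren phi f) (oapp (e w) (w v))].
  by apply: filterS Uphi => w /=; rewrite e1 sat_ren.
pose g (t : option ({p | G p} + {x | E x})) : 'I_1 + ({p | G p} + {x | E x}) :=
  oapp inr (inl ord0) t.
have e2 x : oapp e0 (x ord0) = jn x e0 \o g by apply: funext => -[].
have E'e u : E' (e0 u).
  by case: u => [[p Gp]|[x Ex]]; [right; exists p|left].
rewrite e2 -sat_ren; have [psi psiP] := sat_parameters (ren (ren phi f) g) E'e.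
rewrite psiP; apply: cP; exists (exist _ (ren phi f) Uphi') => x.
by rewrite -psiP sat_ren -e2.
Qed.

Lemma ultra_realized_at : exists c : V -> M, forall phi : formula L (V + {x | E x}),
  sat phi (jn c (@vl L M E)) = U [set v | sat phi (jn v (@vl L M E))].
Proof.
have [G [gG Gmax]] := Zorn_bigcup good_chain.
have /choice[c cG] : forall v, exists x, G (v, x).
  move=> v; apply: contrapT => nx.
  have [x gx] := good_extend gG (fun x h => nx (ex_intro _ x h)).
  apply: (Gmax (G `|` [set (v, x)])) gx; split=> [p|h]; first by left.
  by apply: nx; exists x; apply: h; right.
exists c => phi.
have := gG (ren phi (smap (fun v => exist _ _ (cG v)) id)).
rewrite sat_ren jn_smap => ->; congr U; apply: eq_set => w.
by rewrite sat_ren jn_smap.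
Qed.

End Infinite.

Lemma ultra_realized_small (V : Type) : smallT K V -> ultra_realized V.
Proof. by move=> sV U uU E sE; apply: ultra_realized_at. Qed.

End Saturation.

(** * Small elementary submodels *)

Section LowenheimSkolem.
Variables (L : language) (M : structure L) (K : Type).
Hypothesis hK : uncountable_strong_limit K.
Hypothesis sL : small K [set: Defs.fsym L] /\ small K [set: Defs.rsym L].
Variable m0 : M.

(** The Tarski-Vaught test, for finite tuples of witnesses at once. *)
Definition submodel (N : set M) : Prop :=
  forall (m : nat) (phi : formula L ('I_m + {x | N x})),
  (exists v, sat phi (jn v (@vl L M N))) ->
  exists2 v, forall i, N (v i) & sat phi (jn v (@vl L M N)).

(* Trees over a small alphabet denote all terms and formulas in variables from
   [nat]; this bounds the number of definable relations without an injective
   coding of the syntax. *)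
Local Notation tree := (GenTree.tree (nat + (Defs.fsym L + Defs.rsym L))).

Fixpoint term_value (t : tree) (v : nat -> M) : M :=
  match t with
  | GenTree.Leaf (inl k) => v k
  | GenTree.Node _ (h :: s) =>
      match h with
      | GenTree.Leaf (inr (inl g)) =>
          finterp (fun i : 'I_(farity g) => nth m0 (map (fun u => term_value u v) s) i)
      | _ => m0
      end
  | _ => m0
  end.

Definition scons (b : M) (v : nat -> M) (k : nat) : M := if k is k'.+1 then v k' else b.

Fixpoint formula_value (t : tree) : (nat -> M) -> Prop :=
  match t with
  | GenTree.Node 0 [:: t; u] => fun v => term_value t v = term_value u v
  | GenTree.Node 1 (h :: s) =>
      match h with
      | GenTree.Leaf (inr (inr r)) => fun v =>
          rinterp (fun i : 'I_(rarity r) => nth m0 (map (fun u => term_value u v) s) i)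
      | _ => fun _ => True
      end
  | GenTree.Node 2 [:: t] => fun v => ~ formula_value t v
  | GenTree.Node 3 [:: t; u] => fun v => formula_value t v /\ formula_value u v
  | GenTree.Node 4 [:: t] => fun v => exists b, formula_value t (scons b v)
  | _ => fun _ => True
  end.

Lemma nth_map_codom (T : Type) (k : nat) (f : 'I_k -> T) (g : T -> M) (i : 'I_k) :
  nth m0 (map g (codom f)) i = g (f i).
Proof.
rewrite codomE -map_comp (nth_map i) ?size_enum_ord //.
by rewrite /= nth_ord_enum.
Qed.

Lemma term_tree (V : Type) (t : term L V) (f : V -> nat) :
  exists u, forall v, teval (v \o f) t = term_value u v.
Proof.
elim: t => [x|g ts /choice[us usP]]; first by exists (GenTree.Leaf (inl (f x))).
exists (GenTree.Node 0 (GenTree.Leaf (inr (inl g)) :: codom us)) => v /=.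
by congr finterp; apply: funext => i; rewrite usP nth_map_codom.
Qed.

Lemma formula_tree (V : Type) (phi : formula L V) (f : V -> nat) :
  exists u, forall v, sat phi (v \o f) = formula_value u v.
Proof.
elim: phi f => {V} [V t u|V r ts|V psi IH|V psi IH chi IH'|V psi IH] f.
- have [t' tP] := term_tree t f; have [u' uP] := term_tree u f.
  by exists (GenTree.Node 0 [:: t'; u']) => v /=; rewrite tP uP.
- have /choice[us usP] : forall i, exists u, forall v,
      teval (v \o f) (ts i) = term_value u v.
    by move=> i; apply: term_tree.
  exists (GenTree.Node 1 (GenTree.Leaf (inr (inr r)) :: codom us)) => v /=.
  by congr rinterp; apply: funext => i; rewrite usP nth_map_codom.
- have [t tP] := IH f; exists (GenTree.Node 2 [:: t]) => v /=; by rewrite tP.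
- have [t tP] := IH f; have [u uP] := IH' f.
  by exists (GenTree.Node 3 [:: t; u]) => v /=; rewrite tP uP.
- have [t tP] := IH (fun o => if o is Some x then (f x).+1 else 0).
  exists (GenTree.Node 4 [:: t]) => v /=; congr ex; apply: funext => b.
  by rewrite -tP; congr (sat psi); apply: funext => -[].
Qed.

(** The variables below [m] are those to be witnessed; the later ones are parameters. *)
Definition env (m : nat) (x : nat -> M) (s : seq M) (k : nat) : M :=
  if (k < m)%N then x k else nth m0 s (k - m).

Definition witness (t : tree) (m : nat) (s : seq M) : nat -> M :=
  match pselect (exists x, formula_value t (env m x s)) with
  | left h => projT1 (cid h)
  | right _ => fun=> m0
  end.

(** A Skolem hull: a leaf is an element of [A], and a node labelled [(t, (m, j))] applies the [j]-th
    coordinate of the Skolem function of [t]. The label is stored in the first child, since only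
    leaves of a [GenTree.tree] carry such data. *)
Fixpoint hull_value (A : set M) (t : GenTree.tree ({x | A x} + tree * (nat * nat))) : M :=
  match t with
  | GenTree.Leaf (inl a) => proj1_sig a
  | GenTree.Node _ (h :: s) =>
      match h with
      | GenTree.Leaf (inr (t, (m, j))) => witness t m (map (@hull_value A) s) j
      | _ => m0
      end
  | _ => m0
  end.

Lemma small_submodel (A : set M) : small K A ->
  exists N, [/\ A `<=` N, small K N & submodel N].
Proof.
move=> sA; exists (range (@hull_value A)); split.
- by move=> x Ax; exists (GenTree.Leaf (inl (exist _ x Ax))).
- apply: small_range; apply: small_tree => //; apply: small_sum => //.
    exact: small_sig.
  apply: small_prod => //; last by apply: small_prod => //; apply: small_nat.
  apply: small_tree => //; apply: small_sum => //; first exact: small_nat.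
  by apply: small_sum => //; case: sL.
move=> m phi [v0 hv0].
have [l [s [psi psiP]]] := finite_parameters M phi.
pose f (u : 'I_m + 'I_l) : nat := match u with inl i => i | inr j => m + j end.
have [t tP] := formula_tree psi f.
have /choice[us usP] : forall j : 'I_l, exists u, @hull_value A u = vl (s j).
  by move=> j; have [u _ ue] := proj2_sig (s j); exists u.
pose args := codom us.
have envE (x : nat -> M) : env m x (map (@hull_value A) args) \o f =
    jn (fun i : 'I_m => x i) (@vl _ _ _ \o s).
  apply: funext => -[i|j] /=; first by rewrite /env ltn_ord.
  by rewrite /env ltnNge leq_addr /= addKn nth_map_codom usP.
pose x := witness t m (map (@hull_value A) args).
have hx : formula_value t (env m x (map (@hull_value A) args)).
  rewrite /x /witness; case: pselect => [h|]; first by case: cid.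
  case; exists (fun k => if insub k is Some i then v0 i else m0).
  rewrite -tP envE; move: hv0; rewrite psiP.
  by congr (sat psi (jn _ _)); apply: funext => i; rewrite valK.
exists (fun i : 'I_m => x i) => [i|]; last by rewrite psiP -envE tP.
by exists (GenTree.Node 0 (GenTree.Leaf (inr (t, (m, i : nat))) :: args)).
Qed.

End LowenheimSkolem.

(** * Increasing sequences of natural numbers *)

Definition increasing (f : nat -> nat) : Prop := forall i j, (i < j)%N -> (f i < f j)%N.

Lemma increasing_step (f : nat -> nat) : (forall i, (f i < f i.+1)%N) -> increasing f.
Proof.
move=> h i j; elim: j => // j IH; rewrite ltnS leq_eqVlt => /orP[/eqP -> //|/IH].
by move=> /ltn_trans; apply.
Qed.

Lemma increasing_frequent (P : nat -> Prop) :
  (forall i, exists2 j, (i <= j)%N & P j) -> exists2 f, increasing f & forall i, P (f i).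
Proof.
move=> h; have /choice[g gP] : forall i, exists j, (i <= j)%N /\ P j.
  by move=> i; have [j] := h i; exists j.
pose f := fix f i := if i is i'.+1 then g (f i').+1 else g 0.
exists f; last by case=> [|i]; apply: (gP _).2.
by apply: increasing_step => i /=; apply: (gP _).1.
Qed.

(** [k_inconsistent] speaks of injective families of indices, whereas subsequences of Morley
    sequences are increasing. The given indices are sorted and continued past their maximum. *)
Lemma increasing_enum (k : nat) (l : 'I_k -> nat) : injective l ->
  exists2 f, increasing f & forall i, (i < k)%N -> exists j, f i = l j.
Proof.
move=> lI; pose s := sort leq (codom l).
have ss : sorted ltn s.
  by rewrite ltn_sorted_uniq_leq sort_uniq (sort_sorted leq_total) map_inj_uniq ?enum_uniq.
have sz : size s = k by rewrite size_sort size_codom card_ord.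
pose m := \max_(x <- s) x.
exists (fun i => if (i < k)%N then nth 0 s i else m + i.+1).
  move=> i j ij; case: (ltnP j k) => jk.
    by rewrite (ltn_trans ij jk) (sorted_ltn_nth ltn_trans) ?inE ?sz ?(ltn_trans ij jk).
  case: (ltnP i k) => ik; last by rewrite ltn_add2l.
  rewrite addnS ltnS (leq_trans _ (leq_addr _ _)) //.
  apply: (@leq_bigmax_seq _ s xpredT id (nth 0 s i)) => //.
  by rewrite mem_nth ?sz.
move=> i ik; rewrite ik.
have : nth 0 s i \in codom l by rewrite -(mem_sort leq) mem_nth ?sz.
by move=> /codomP[j ->]; exists j.
Qed.

Section Monster.
Variables (L : language) (T : set (sentence L)) (M : structure L) (K : Type).
Hypothesis hM : monster M K T.

Let hK : uncountable_strong_limit K. Proof. by case: hM. Qed.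
Let hS : saturated M K. Proof. by case: hM. Qed.
Let hH : strongly_homogeneous M K. Proof. by case: hM. Qed.
Let sL : small K [set: Defs.fsym L] /\ small K [set: Defs.rsym L].
Proof. by case: hM. Qed.

Lemma submodel_exists (A : set M) : small K A ->
  exists N, [/\ A `<=` N, small K N & submodel N].
Proof. by have [m0] := carrier_inhabited M; apply: small_submodel. Qed.

Lemma submodel_aut (N : set M) (g : M -> M) : automorphism g -> submodel N ->
  submodel (g @` N).
Proof.
move=> ag hN m phi [v hv].
have /choice[f fP] : forall p : {x | (g @` N) x}, exists q : {x | N x}, g (vl q) = vl p.
  by move=> [x px]; rewrite /vl /=; case: px => y Ny yx; exists (exist _ y Ny).
have e w : jn (g \o w) (@vl _ _ (g @` N)) = g \o (jn w (@vl _ _ N) \o smap id f).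
  by rewrite jn_smap comp_jn; congr jn; apply: funext => p /=; rewrite fP.
have [h [ah gh hg]] := aut_inv ag.
have [|w wN hw] := hN m (ren phi (smap id f)).
  exists (h \o v); rewrite sat_ren -(sat_aut ag) -e.
  by have -> : g \o (h \o v) = v by apply: funext => i /=; rewrite hg.
exists (g \o w); first by move=> i; exists (w i).
by rewrite e sat_aut // -sat_ren.
Qed.

(** * Dividing *)

Definition cpf (n : nat) (g : M -> M) (psi : pformula M n) : pformula M n :=
  PFormula (pfml psi) (g \o par psi).

Lemma psat_cpf (n : nat) (g : M -> M) (psi : pformula M n) c :
  automorphism g -> psat (g \o c) (cpf g psi) = psat c psi.
Proof.
move=> ag; rewrite /psat -(sat_aut ag (pfml psi)); congr sat.
by apply: funext => -[].
Qed.

(** Automorphisms replace sequences of parameters because they also move realizations and trees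
    lying over the formula. *)
Lemma divides_aut (n : nat) (A : set M) (psi : pformula M n) :
  small K A -> divides A psi -> exists k (g : nat -> M -> M),
    (forall i, aut_over A (g i)) /\ k_inconsistent k (fun i => cpf (g i) psi).
Proof.
move=> sA [k [b [bP kb]]].
have /choice[g gP] : forall i, exists g, aut_over A g /\ g \o par psi = b i.
  move=> i; have [|g] := homogeneous hK hH (a := par psi) (b := b i) sA (small_fin hK _).
    by apply/tp_eqv; rewrite bP.
  by exists g.
exists k, g; split=> [i|]; first exact: (gP i).1.
by move=> i iI [c hc]; apply: (kb i iI); exists c => l; rewrite -(gP _).2; apply: hc.
Qed.

Lemma aut_divides (n : nat) (A : set M) (psi : pformula M n) (k : nat) (g : nat -> M -> M) :
  (forall i, aut_over A (g i)) -> k_inconsistent k (fun i => cpf (g i) psi) ->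
  divides A psi.
Proof.
move=> gA kg; exists k, (fun i => g i \o par psi); split=> // i.
by apply/tp_eqv; apply: aut_eqv.
Qed.

Lemma divides_cpf (n : nat) (A : set M) (psi : pformula M n) (g : M -> M) :
  small K A -> aut_over A g -> divides A psi -> divides A (cpf g psi).
Proof.
move=> sA gA /(divides_aut sA)[k [f [fA kf]]].
have [h [hA gh hg]] := aut_over_inv gA.
apply: (aut_divides (k := k) (g := fun i => f i \o h)).
  by move=> i; apply: aut_over_comp.
suff -> : (fun i => cpf (f i \o h) (cpf g psi)) = (fun i => cpf (f i) psi) by [].
apply: funext => i; rewrite /cpf /=; congr PFormula.
by apply: funext => j /=; rewrite gh.
Qed.

Lemma nondividing (n : nat) (A : set M) (psi : pformula M n) (g : nat -> M -> M) (k : nat) :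
  ~ divides A psi -> (forall i, aut_over A (g i)) ->
  exists2 l : 'I_k -> nat, injective l & exists c, forall j, psat c (cpf (g (l j)) psi).
Proof.
move=> nd gA; apply: contrapT => nl; apply: nd; apply: (aut_divides gA (k := k)) => l lI.
by move=> hc; apply: nl; exists l.
Qed.

Definition nondividing_over (n : nat) (A E : set M) (c : 'I_n -> M) : Prop :=
  forall psi : pformula M n, Defs.over E psi -> psat c psi -> ~ divides A psi.

(** * Global types as ultrafilters *)

Section Global.
Variables (V : Type) (U : set_system (V -> M)).

(* [d] realizes the restriction to [E] of the global type given by [U]. *)
Definition real (E : set M) (d : V -> M) : Prop :=
  forall phi : formula L (V + {x | E x}),
    sat phi (jn d (@vl _ _ E)) = U [set v | sat phi (jn v (@vl _ _ E))].

Definition inv_over (N : set M) : Prop :=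
  forall (W : Type) (phi : formula L (V + W)) (e e' : W -> M), smallT K W ->
    eqv N e e' -> U [set v | sat phi (jn v e)] = U [set v | sat phi (jn v e')].

Lemma real_sat (E : set M) (d : V -> M) (W : Type) (e : W -> M) :
  real E d -> (forall w, E (e w)) -> forall phi : formula L (V + W),
  sat phi (jn d e) = U [set v | sat phi (jn v e)].
Proof.
move=> rd Ee phi; have [psi psiP] := sat_parameters phi Ee.
by rewrite psiP rd; congr U; apply: eq_set => v; rewrite psiP.
Qed.

Lemma real_sub (E F : set M) (d : V -> M) : F `<=` E -> real E d -> real F d.
Proof. by move=> FE rd phi; apply: (real_sat rd) => -[x Fx]; apply: FE. Qed.

Lemma real_eqv (E : set M) (d d' : V -> M) : real E d -> real E d' -> eqv E d d'.
Proof. by move=> r r' phi; rewrite r r'. Qed.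

Lemma eqv_real (E : set M) (d d' : V -> M) : eqv E d d' -> real E d -> real E d'.
Proof. by move=> h r phi; rewrite -h r. Qed.

End Global.

(** * Sequences *)

Lemma small_sequence (X : Type) (P : set M -> X -> Prop) (supp : X -> set M) (E0 : set M) :
  small K E0 -> (forall x, small K (supp x)) ->
  (forall E, small K E -> exists x, P E x) ->
  exists x : nat -> X,
    forall i, P (E0 `|` [set y | exists2 j, (j < i)%N & supp (x j) y]) (x i).
Proof.
move=> sE0 sX hP.
have [x0 _] := hP _ sE0.
have sU (s : nat -> X) i : small K (E0 `|` [set y | exists2 j, (j < i)%N & supp (s j) y]).
  apply: small_setU => //; elim: i => [|i IH].
    by apply: small_sub sE0 => y [].
  apply: small_sub (small_setU hK IH (sX (s i))) => y [j].
  rewrite ltnS leq_eqVlt => /orP[/eqP -> |ji] h; first by right.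
  by left; exists j.
have /choice[f fP] : forall u : nat * (nat -> X), exists x,
    P (E0 `|` [set y | exists2 j, (j < u.1)%N & supp (u.2 j) y]) x.
  by move=> [i s]; apply: hP.
(* [g i] stores the terms before [i], with the filler [x0] from [i] on; entries below [i] never
   change afterwards. *)
pose g := fix g i : nat -> X :=
  if i is i'.+1 then (fun j => if j == i' then f (i', g i') else g i' j) else fun=> x0.
exists (fun i => f (i, g i)) => i.
suff -> : [set y | exists2 j, (j < i)%N & supp (f (j, g j)) y] =
    [set y | exists2 j, (j < i)%N & supp (g i j) y] by exact: (fP (i, g i)).
suff gE j : (j < i)%N -> g i j = f (j, g j).
  by apply/seteqP; split=> y [j ji hy]; exists j => //; rewrite ?gE // -gE.
elim: i j => //= i IH j; rewrite ltnS leq_eqVlt; have [-> //|ne /= ji] := eqVneq j i.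
exact: IH.
Qed.

Definition previous (V : Type) (D : nat -> V -> M) (i : nat) : set M :=
  [set y | exists2 j, (j < i)%N & range (D j) y].

Definition morley (V : Type) (U : set_system (V -> M)) (E : set M) (D : nat -> V -> M) : Prop :=
  forall i, real U (E `|` previous D i) (D i).

Definition flat (V : Type) (D : nat -> V -> M) (p : nat * V) : M := D p.1 p.2.

Lemma morley_exists (V : Type) (U : set_system (V -> M)) (E : set M) :
  smallT K V -> UltraFilter U -> small K E -> exists D, morley U E D.
Proof.
move=> sV uU sE.
apply: (small_sequence (P := real U) (supp := fun d => range d)) => // [x|F sF].
  exact: small_range.
exact: (ultra_realized_small hK hS sV).
Qed.

Lemma morley_sub (V : Type) (U : set_system (V -> M)) (E F : set M) D :
  F `<=` E -> morley U E D -> morley U F D.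
Proof. by move=> FE hD i; apply: real_sub (hD i); apply: setSU. Qed.

Lemma morley_real (V : Type) (U : set_system (V -> M)) (E : set M) D i :
  morley U E D -> real U E (D i).
Proof. by move=> hD; apply: real_sub (hD i); apply: subsetUl. Qed.

Lemma morley_comp (V : Type) (U : set_system (V -> M)) (E : set M) D f :
  increasing f -> morley U E D -> morley U E (D \o f).
Proof.
move=> fi hD i; apply: real_sub (hD (f i)); apply: setUS => y [j ji hy].
by exists (f j) => //; apply: fi.
Qed.

Lemma eqv_flat (N : set M) (V W : Type) (e e' : W -> M) (D D' : nat -> V -> M) :
  (forall k, eqv N (jn e (fun p : 'I_k * V => D p.1 p.2))
                   (jn e' (fun p : 'I_k * V => D' p.1 p.2))) ->
  eqv N (jn e (flat D)) (jn e' (flat D')).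
Proof.
move=> h phi; have [F Ff FP] := sat_support M phi.
pose idx (u : (W + nat * V) + {x | N x}) : nat :=
  match u with inl (inr p) => p.1 | _ => 0 end.
have /finite_seqP[s sE] : finite_set (idx @` F) by apply: finite_image.
pose k := (\max_(x <- s) x).+1.
have Fk u : F u -> (idx u < k)%N.
  move=> Fu; rewrite ltnS; apply: (@leq_bigmax_seq _ s xpredT id (idx u)) => //.
  have : (idx @` F) (idx u) by exists u.
  by rewrite sE.
pose f := smap (smap (@id W) (fun p : nat * V => (inord p.1 : 'I_k, p.2))) (@id {x | N x}).
have eq (a : W -> M) (G : nat -> V -> M) : sat phi (jn (jn a (flat G)) (@vl _ _ N)) =
    sat (ren phi f) (jn (jn a (fun p : 'I_k * V => G p.1 p.2)) (@vl _ _ N)).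
  rewrite sat_ren jn_smap jn_smap; apply: FP => -[[w|[i v]]|q] //= /Fk /= ik.
  by rewrite /flat /= inordK.
by rewrite !eq h.
Qed.

(** Induction on the number of terms: the next term realizes [U] over all that precedes it, and
    invariance lets that part be replaced by one of the same type over [N]. The tuples [e] and [e']
    in front allow comparing points together with Morley sequences taken over them. *)
Lemma morley_eqv (V W : Type) (U : set_system (V -> M)) (N : set M) (e e' : W -> M) D D' :
  small K N -> smallT K V -> smallT K W -> inv_over U N -> eqv N e e' ->
  morley U (N `|` range e) D -> morley U (N `|` range e') D' ->
  eqv N (jn e (flat D)) (jn e' (flat D')).
Proof.
move=> sN sV sW iU ee hD hD'; apply: eqv_flat; elim=> [|k IH] phi.
  have eq (a : W -> M) (G : nat -> V -> M) :
      jn (jn a (fun p : 'I_0 * V => G p.1 p.2)) (@vl _ _ N) =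
      jn a (@vl _ _ N) \o (fun u : (W + 'I_0 * V) + {x | N x} => match u with
        | inl (inl w) => inl w
        | inl (inr p) => match notF (ltn_ord p.1) with end
        | inr q => inr q end).
    by apply: funext => -[[w|[[]]]|].
  by rewrite !eq -!sat_ren.
pose f (u : (W + 'I_k.+1 * V) + {x | N x}) : V + ((W + 'I_k * V) + {x | N x}) :=
  match u with
  | inl (inl w) => inr (inl (inl w))
  | inl (inr p) => if unlift ord_max p.1 is Some j then inr (inl (inr (j, p.2))) else inl p.2
  | inr q => inr (inr q)
  end.
pose t (a : W -> M) (G : nat -> V -> M) := jn (jn a (fun p : 'I_k * V => G p.1 p.2)) (@vl _ _ N).
have eq (a : W -> M) (G : nat -> V -> M) :
    jn (jn a (fun p : 'I_k.+1 * V => G p.1 p.2)) (@vl _ _ N) = jn (G k) (t a G) \o f.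
  apply: funext => -[[w|[i v]]|q] //=.
  by case: unliftP => [j|] -> //=; rewrite /bump leqNgt ltn_ord add0n.
have tE (a : W -> M) G u : ((N `|` range a) `|` previous G k) (t a G u).
  case: u => [[w|[j v]]|[x Nx]] /=; first by left; right; exists w.
    by right; exists j => //; exists v.
  by left; left.
rewrite !eq -!sat_ren (real_sat (hD k) (tE e D)) (real_sat (hD' k) (tE e' D')).
apply: iU; last by apply: eqv_jn => // -[].
apply: small_sum => //; last exact: small_sig.
by apply: small_sum => //; apply: small_prod => //; apply: small_fin.
Qed.

Definition noW (u : void) : M := match u with end.

Lemma range_noW (N : set M) : N `|` range noW = N.
Proof. by apply/seteqP; split=> x; [case=> // -[]|left]. Qed.

Lemma morley_eqv0 (V : Type) (U : set_system (V -> M)) (N : set M) D D' :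
  small K N -> smallT K V -> inv_over U N ->
  morley U N D -> morley U N D' -> eqv N (flat D) (flat D').
Proof.
move=> sN sV iU hD hD'.
have := @morley_eqv V void U N noW noW D D' sN sV (small_fin hK _) iU (@eqv_refl _ _ N _ noW).
by rewrite !range_noW => /(_ hD hD') /(eqv_comp inr).
Qed.

(* Replacing a tail of a Morley sequence by the tail of a Morley sequence over
   more parameters can be undone by an automorphism; this is how a single
   alternation becomes an instance of the order property. *)
Lemma splice (V : Type) (U : set_system (V -> M)) (N : set M) D D' :
  small K N -> smallT K V -> inv_over U N ->
  morley U N D -> morley U (N `|` range (flat D)) D' ->
  exists g : nat -> M -> M, (forall j, aut_over N (g j)) /\
    forall i j, g j \o (if (i < j)%N then D i else D' i) = D i.
Proof.
move=> sN sV iU hD hD'.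
have /choice[g gP] : forall j, exists g, aut_over N g /\
    g \o flat (fun i => if (i < j)%N then D i else D' i) = flat D.
  move=> j; have [||g gN gE] := @homogeneous _ _ K hK hH N _
     (flat (fun i => if (i < j)%N then D i else D' i)) (flat D) sN.
  - by apply: small_prod => //; apply: small_nat.
  (* The terms of [D] before [j] followed by those of [D'] from [j] on are again a Morley sequence
     over [N], hence have the type of [D]. *)
  - apply: (morley_eqv0 sN sV iU) => // i.
    have [ij|ji] := ltnP i j.
      apply: real_sub (hD i); apply: setUS => y [k ki].
      by rewrite (ltn_trans ki ij) => hy; exists k.
    apply: real_sub (hD' i) => y [Ny|[k ki]]; first by left; left.
    case: ifP => kj hy; last by right; exists k.
    by left; right; case: hy => v _ <-; exists (k, v).
  by exists g.
exists g; split=> [j|i j]; first exact: (gP j).1.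
by apply: funext => v; have := congr1 (fun h => h (i, v)) (gP j).2.
Qed.

(** * The order property *)

(* Parameters are absorbed in the tuples [bs j], so [phi] is a formula of [L].
   The diagonal [i = j] is left unspecified. *)
Definition order_property (n : nat) (A : set M) (c : 'I_n -> M) : Prop :=
  exists (W : Type) (phi : formula L ('I_n + W)) (cs : nat -> 'I_n -> M) (bs : nat -> W -> M),
  [/\ smallT K W, forall i, eqv A c (cs i)
    & forall i j, ((i < j)%N -> sat phi (jn (cs i) (bs j))) /\
                  ((j < i)%N -> ~ sat phi (jn (cs i) (bs j)))].

Lemma order_property_opp (n : nat) (A : set M) (c : 'I_n -> M) (W : Type)
    (phi : formula L ('I_n + W)) (cs : nat -> 'I_n -> M) (bs : nat -> W -> M) :
  smallT K W -> (forall i, eqv A c (cs i)) ->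
  (forall i j, ((i < j)%N -> ~ sat phi (jn (cs i) (bs j))) /\
               ((j < i)%N -> sat phi (jn (cs i) (bs j)))) ->
  order_property A c.
Proof.
move=> sW hc h; exists W, (fNot phi), cs, bs; split=> // i j; split=> ij /=.
  exact: (h i j).1.
by move=> nh; apply: nh; apply: (h i j).2.
Qed.

Lemma order_property_eqv (n : nat) (A : set M) (c d : 'I_n -> M) :
  eqv A c d -> order_property A d -> order_property A c.
Proof.
move=> cd [W [phi [cs [bs [sW hc h]]]]]; exists W, phi, cs, bs; split=> // i.
exact: eqv_trans cd (hc i).
Qed.

(** The filter is generated by the solutions in [N] of formulas of the type of [b] over [N]; the
    Tarski-Vaught test makes them nonempty. Since [U] concentrates on tuples from [N], the truth of
    [phi (v, e)] for almost all [v] depends only on the type of [e] over [N]. *)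
Lemma coheir_exists (m : nat) (b : 'I_m -> M) (N : set M) : submodel N ->
  exists U : set_system ('I_m -> M), [/\ UltraFilter U, inv_over U N & real U N b].
Proof.
move=> hN.
pose I := {phi : formula L ('I_m + {x | N x}) | sat phi (jn b (@vl _ _ N))}.
pose S (i : I) := [set v : 'I_m -> M | (forall j, N (v j)) /\ sat (proj1_sig i) (jn v (@vl _ _ N))].
have PF : ProperFilter (filter_from setT S).
  apply: filter_from_proper => [|[phi bphi] _]; last first.
    by have [|v vN hv] := hN m phi; [exists b|exists v].
  apply: filter_from_filter; first by exists (exist _ (ftrue L _) (sat_true _)).
  move=> [phi bphi] [psi bpsi] _ _.
  by exists (exist _ (fAnd phi psi) (conj bphi bpsi)) => // v [vN []].
have [U [uU SU]] := ultraFilterLemma PF.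
have bU (phi : formula L ('I_m + {x | N x})) : sat phi (jn b (@vl _ _ N)) ->
    U [set v | (forall j, N (v j)) /\ sat phi (jn v (@vl _ _ N))].
  by move=> h; apply: SU; exists (exist _ phi h).
exists U; split=> //.
  move=> W phi e e' _ ee.
  have UN : U [set v | forall j, N (v j)].
    by apply: filterS (bU _ (sat_true (jn b (@vl _ _ N)))) => v [].
  have vE (v : 'I_m -> M) : (forall j, N (v j)) -> sat phi (jn v e) = sat phi (jn v e').
    move=> vN; pose sw (u : 'I_m + W) : W + 'I_m :=
      match u with inl i => inr i | inr w => inl w end.
    have eq (a : W -> M) : jn v a = jn a v \o sw by apply: funext => -[].
    by rewrite !eq -!sat_ren; apply: (eqv_sat ee).
  apply/propext; split=> h; apply: filterS (filterI UN h) => v [vN] /=.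
    by rewrite vE.
  by rewrite vE.
move=> phi; apply/propext; split=> [/bU|h]; first by apply: filterS => v [].
apply: contrapT => nb; have /bU h' : sat (fNot phi) (jn b (@vl _ _ N)) by [].
by have [v [? []]] := filter_ex (filterI h h').
Qed.

(* If [phi (x, b)] does not divide over [A], some [e] satisfies it along a whole
   Morley sequence of the coheir [U] of [tp (b / N)]; if [phi (e, y)] were not in
   [U], continuing the sequence over [e] would give the order property. *)
Lemma nondividing_coheir (n m : nat) (A N E : set M) (c : 'I_n -> M) (b : 'I_m -> M)
    (U : set_system ('I_m -> M)) (phi : formula L ('I_n + 'I_m)) :
  ~ order_property A c -> small K N -> A `<=` N -> N `<=` E -> (forall j, E (b j)) ->
  nondividing_over A E c -> UltraFilter U -> inv_over U N -> real U N b ->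
  sat phi (jn c b) ->
  exists2 e, eqv N c e & U [set v | sat phi (jn e v)].
Proof.
move=> stc sN AN NE Eb ndc uU iU rb cb.
have sm := small_fin hK 'I_m.
have [D hD] := morley_exists sm uU sN.
have /choice[g gP] : forall i, exists g, aut_over N g /\ g \o b = D i.
  move=> i; have [|g] := homogeneous hK hH (a := b) (b := D i) sN sm; last by exists g.
  by apply: real_eqv rb (morley_real i hD).
have step (th : formula L ('I_n + {x | N x})) k : sat th (jn c (@vl _ _ N)) ->
    exists e, sat th (jn e (@vl _ _ N)) /\ forall i, (i < k)%N -> sat phi (jn e (D i)).
  move=> cth.
  have [chi chiP] : exists chi : formula L ('I_n + {x | E x}), forall x,
      sat chi (jn x (@vl _ _ E)) = (sat th (jn x (@vl _ _ N)) /\ sat phi (jn x b)).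
    pose f1 := smap (@id 'I_n) (@inl {x | N x} 'I_m).
    pose f2 := smap (@id 'I_n) (@inr {x | N x} 'I_m).
    have [|chi chiP] := @sat_parameters _ _ E 'I_n _ (jn (@vl _ _ N) b)
      (fAnd (ren th f1) (ren phi f2)).
      by move=> [[x Nx]|j] /=; [apply: NE|apply: Eb].
    by exists chi => x; rewrite -chiP /= !sat_ren !jn_smap.
  have [psi o psiP] := pformula_of_formula chi.
  have nd : ~ divides A psi by apply: ndc => //; rewrite psiP chiP.
  have [l lI [d dP]] := nondividing k nd (fun i => aut_over_sub AN (gP i).1).
  have dD j : sat th (jn d (@vl _ _ N)) /\ sat phi (jn d (D (l j))).
    have [h [hN gh hg]] := aut_over_inv (gP (l j)).1.
    have [[ag gN] gb] := gP (l j).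
    have := dP j; have -> : d = g (l j) \o (h \o d) by apply: funext => i /=; rewrite hg.
    rewrite psat_cpf // psiP chiP => -[h1 h2]; split.
      by rewrite (aut_eqv _ (gP (l j)).1).
    by rewrite -gb -comp_jn sat_aut.
  (* The indices [l j] provided by nondividing are arbitrary. Sorted, they begin a Morley
     subsequence of [D], which an automorphism over [N] moves onto [D] itself. *)
  have [f fi fl] := increasing_enum lI.
  have [||rho rhoN rhoD] := @homogeneous _ _ K hK hH N _ (flat (D \o f)) (flat D) sN.
  - by apply: small_prod => //; apply: small_nat.
  - by apply: (morley_eqv0 sN sm iU) => //; apply: morley_comp.
  (* For [k = 0] there is no index from which [th] could be read off at [d], but [c] itself
     works. *)
  case: k l lI dP dD fl {nd} => [|k] l lI dP dD fl.
    by exists c.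
  exists (rho \o d); split; first by rewrite (aut_eqv _ rhoN); apply: (dD ord0).1.
  move=> i ik; have [j fij] := fl i ik.
  have -> : D i = rho \o D (l j).
    by apply: funext => v; rewrite -fij -[D i v]/(flat D (i, v)) -rhoD.
  by rewrite -comp_jn (sat_aut rhoN.1); apply: (dD j).2.
have sD : small K (range (flat D)).
  by apply: small_range; apply: small_prod => //; apply: small_nat.
have [e [ce eD]] : exists e, eqv N c e /\ forall i, sat phi (jn e (D i)).
  pose I := ({th : formula L ('I_n + {x | N x}) | sat th (jn c (@vl _ _ N))} * nat)%type.
  pose S (i : I) := [set e | sat (proj1_sig i.1) (jn e (@vl _ _ N)) /\
    forall j, (j < i.2)%N -> sat phi (jn e (D j))].
  pose t0 : {th : formula L ('I_n + {x | N x}) | sat th (jn c (@vl _ _ N))} :=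
    exist _ (ftrue L _) (sat_true _).
  have [||e eP] := @directed_realized _ _ K _ (@ultra_realized_fin _ _ K hS n)
    (N `|` range (flat D)) I (t0, 0) S (small_setU hK sN sD).
  - by move=> [[th hth] k]; have [e he] := step th k hth; exists e.
  - move=> [[th hth] k] [[th' hth'] k'].
    exists (exist (fun th => sat th (jn c (@vl _ _ N))) (fAnd th th') (conj hth hth'), maxn k k').
    move=> e [[h h'] hD']; split; split=> // j jk; apply: hD' => /=.
      by rewrite leq_max jk.
    by rewrite leq_max jk orbT.
  exists e; split.
    apply: eqv_imp => th hth.
    have [|th' thP] := @sat_parameters _ _ (N `|` range (flat D)) 'I_n _ (@vl _ _ N) th.
      by move=> [x Nx]; left.
    rewrite thP; apply: eP; exists (exist _ th hth, 0) => v [] /=.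
    by rewrite thP.
  move=> i.
  have [|th' thP] := @sat_parameters _ _ (N `|` range (flat D)) 'I_n _ (D i) phi.
    by move=> v; right; exists (i, v).
  rewrite thP; apply: eP; exists (t0, i.+1) => v [_ h] /=.
  by rewrite -thP; apply: h.
exists e => //; apply: contrapT; rewrite -ultra_setC => nU; apply: stc.
have [D' hD'] := @morley_exists _ U ((N `|` range (flat D)) `|` range e) sm uU
  (small_setU hK (small_setU hK sN sD) (small_range _ (small_fin hK _))).
have eD' i : ~ sat phi (jn e (D' i)).
  pose sw (u : 'I_n + 'I_m) : 'I_m + 'I_n := match u with inl i => inr i | inr w => inl w end.
  have eq v : jn e v = jn v e \o sw by apply: funext => -[].
  have := @real_sat _ U _ _ _ e (morley_real i hD') _ (fNot (ren phi sw)).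
  rewrite /= sat_ren -eq => -> //; last by move=> w; right; exists w.
  by apply: filterS nU => v /=; rewrite sat_ren -eq.
have [|rho [rhoN rhoD]] := splice sN sm iU hD (D' := D').
  by apply: morley_sub hD'; apply: subsetUl.
have rhoE i j : sat phi (jn (rho j \o e) (D i)) =
    sat phi (jn e (if (i < j)%N then D i else D' i)).
  by rewrite -{1}(rhoD i j) -comp_jn sat_aut //; case: (rhoN j).
apply: (@order_property_opp _ _ _ _ phi (fun j => rho j \o e) D sm).
  move=> i; apply: eqv_trans (eqv_sub AN ce) (eqv_sym _).
  by apply: aut_eqv; apply: aut_over_sub (rhoN i).
move=> i j; split=> ij; rewrite rhoE.
  by rewrite ltnNge (ltnW ij); apply: eD'.
by rewrite ij; apply: eD.
Qed.

(** If a formula with parameters [b] separates [c1] from [c2], one coheir [U] of the type of [b]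
    over [N] contains [phi (e1, y)] and [~ phi (e2, y)] for some [e1] and [e2] of the same type over
    [N], against invariance of [U]. *)
Lemma nondividing_unique (n : nat) (A N E : set M) (c1 c2 : 'I_n -> M) :
  ~ order_property A c1 -> small K N -> submodel N -> A `<=` N -> N `<=` E ->
  eqv N c1 c2 -> nondividing_over A E c1 -> nondividing_over A E c2 -> eqv E c1 c2.
Proof.
move=> st1 sN mN AN NE c12 nd1 nd2; apply: eqv_imp => th h1; apply: contrapT => h2.
have st2 : ~ order_property A c2.
  by apply: contra_not st1; apply: order_property_eqv; apply: eqv_sub c12.
have [m [s [phi phiP]]] := finite_parameters M th.
pose b := @vl _ _ E \o s; have bE j : E (b j) by apply: proj2_sig.
have [U [uU iU rb]] := coheir_exists b mN.
rewrite phiP in h1; rewrite phiP in h2.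
have [e1 c1e U1] := nondividing_coheir st1 sN AN NE bE nd1 uU iU rb h1.
have [e2 c2e U2] := nondividing_coheir (phi := fNot phi) st2 sN AN NE bE nd2 uU iU rb h2.
have e12 : eqv N e1 e2.
  exact: eqv_trans (eqv_sym c1e) (eqv_trans c12 c2e).
pose sw (u : 'I_n + 'I_m) : 'I_m + 'I_n := match u with inl i => inr i | inr w => inl w end.
have eq (a : 'I_n -> M) v : jn a v = jn v a \o sw by apply: funext => -[].
have Ue a : U [set v | sat phi (jn a v)] = U [set v | sat (ren phi sw) (jn v a)].
  by congr U; apply: eq_set => v; rewrite eq sat_ren.
move: U1; rewrite Ue (iU _ _ _ _ (small_fin hK _) e12) -Ue => U1.
by have [v []] := filter_ex (filterI U1 U2).
Qed.

End Monster.

(** * Conjugacy of nonforking extensions *)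

Section Conjugacy.
Variables (L : language) (T : set (sentence L)) (M : structure L) (K : Type).
Hypothesis hM : monster M K T.

Let hK : uncountable_strong_limit K. Proof. by case: hM. Qed.
Let hS : saturated M K. Proof. by case: hM. Qed.
Let hH : strongly_homogeneous M K. Proof. by case: hM. Qed.

Definition nondividing_ultra (n : nat) (A : set M) (U : set_system ('I_n -> M)) : Prop :=
  forall psi : pformula M n, divides A psi -> ~ U [set v | psat v psi].

Lemma real_psat (n : nat) (E : set M) (U : set_system ('I_n -> M)) d (psi : pformula M n) :
  real U E d -> Defs.over E psi -> psat d psi = U [set v | psat v psi].
Proof. by move=> rd o; apply: (real_sat rd o). Qed.

Lemma nondividing_real (n : nat) (A E : set M) (U : set_system ('I_n -> M)) d :
  nondividing_ultra A U -> real U E d -> nondividing_over A E d.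
Proof. by move=> ndU rd psi o; rewrite (real_psat rd o) => h /ndU. Qed.

Lemma real_exists (n : nat) (E : set M) (U : set_system ('I_n -> M)) :
  UltraFilter U -> small K E -> exists d, real U E d.
Proof. by move=> uU sE; have [d dP] := ultra_realized_fin hS uU sE; exists d. Qed.

(** Let [d] realize [U] over [N], [e] and [e'], and let [s] fix [N] and map [e] to [e']. Both [d]
    and [s \o d] are nondividing over [A] on [N] with [e'], and they agree over [N]. By uniqueness
    [phi (d, e')] is equivalent to [phi (s d, e')], that is, to [phi (d, e)]. *)
Lemma nondividing_invariant (n : nat) (A N : set M) (U : set_system ('I_n -> M)) c :
  UltraFilter U -> nondividing_ultra A U -> real U A c -> ~ order_property K A c ->
  small K N -> submodel N -> A `<=` N -> inv_over K U N.
Proof.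
move=> uU ndU rc stc sN mN AN W phi e e' sW ee.
have sA := small_sub AN sN.
have [s sE sEe] := homogeneous hK hH sN sW ee.
have sW1 := small_range e sW; have sW2 := small_range e' sW.
have [d rd] := real_exists uU (small_setU hK (small_setU hK sN sW1) sW2).
have [t [tE st ts]] := aut_over_inv sE.
have nd1 : nondividing_over A (N `|` range e') d.
  apply: nondividing_real ndU _; apply: real_sub rd => x [Nx|h]; last by right.
  by left; left.
have nd2 : nondividing_over A (N `|` range e') (s \o d).
  move=> psi o hd dv; have [as_ _] := sE.
  have tpsi : cpf s (cpf t psi) = psi.
    case: psi {o hd dv} => l f p; rewrite /cpf /=; congr PFormula.
    by apply: funext => j /=; rewrite ts.
  apply: (ndU (cpf t psi)).
    by apply: (divides_cpf hM sA _ dv); apply: aut_over_sub tE.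
  rewrite -(real_psat rd); first by rewrite -(psat_cpf _ _ as_) tpsi.
  move=> j /=; have [Nx|[w _ <-]] := o j.
    by left; left; rewrite (tE.2 _ Nx).
  by left; right; exists w => //; rewrite -sEe /= st.
have dd : eqv N d (s \o d) by apply: eqv_sym; apply: aut_eqv.
have Ad : eqv A c d.
  by apply: real_eqv rc _; apply: real_sub rd => x /AN Nx; left; left.
have std : ~ order_property K A d by apply: contra_not stc; apply: order_property_eqv.
have dd' : eqv (N `|` range e') d (s \o d).
  by apply: (nondividing_unique hM std sN mN AN _ dd nd1 nd2) => x; left.
rewrite -(real_sat rd); last by move=> w; left; right; exists w.
rewrite -(real_sat rd); last by move=> w; right; exists w.
rewrite [in RHS](eqv_sat dd'); last by move=> w; right; exists w.
by rewrite -sEe -comp_jn sat_aut //; case: sE.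
Qed.

Definition push (n : nat) (g : M -> M) (U : set_system ('I_n -> M)) : set_system ('I_n -> M) :=
  fmap (fun v => g \o v) U.

Lemma push_ultra (n : nat) (g : M -> M) (U : set_system ('I_n -> M)) :
  UltraFilter U -> UltraFilter (push g U).
Proof.
move=> uU; split; first exact: fmap_proper_filter.
move=> G PG UG; apply/seteqP; split=> // S GS.
apply: contrapT => nS; have : push g U (~` S) by rewrite /push /fmap /= preimage_setC ultra_setC.
by move=> /UG nGS; have [v []] := filter_ex (filterI GS nGS).
Qed.

Lemma push_sat (n : nat) (g : M -> M) (U : set_system ('I_n -> M)) (W : Type)
    (phi : formula L ('I_n + W)) (e : W -> M) : automorphism g ->
  push g U [set v | sat phi (jn v (g \o e))] = U [set v | sat phi (jn v e)].
Proof.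
move=> ag; rewrite /push /fmap /=; congr U; apply: eq_set => v /=.
by rewrite -comp_jn sat_aut.
Qed.

Lemma push_nondividing (n : nat) (A : set M) (g : M -> M) (U : set_system ('I_n -> M)) :
  UltraFilter U -> small K A -> aut_over A g -> nondividing_ultra A U ->
  nondividing_ultra A (push g U).
Proof.
move=> uU sA gA ndU psi dv; have [t [tA gt tg]] := aut_over_inv gA.
have -> : psi = cpf g (cpf t psi).
  case: psi {dv} => l f p; rewrite /cpf /=; congr PFormula.
  by apply: funext => j /=; rewrite tg.
rewrite /push /fmap /= => h; apply: ndU (divides_cpf hM sA tA dv) _.
by apply: filterS h => v /=; rewrite psat_cpf //; case: gA.
Qed.

Lemma push_real (n : nat) (E : set M) (g : M -> M) (U : set_system ('I_n -> M)) d :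
  automorphism g -> real U E d -> real (push g U) (g @` E) (g \o d).
Proof.
move=> ag rd phi.
have /choice[f fP] : forall p : {x | (g @` E) x}, exists q : {x | E x}, g (vl q) = vl p.
  by move=> [x px]; rewrite /vl /=; case: px => y Ny yx; exists (exist _ y Ny).
have -> : @vl _ _ (g @` E) = g \o (@vl _ _ E \o f) by apply: funext => p /=; rewrite fP.
rewrite push_sat // -comp_jn sat_aut //; apply: (real_sat rd) => w.
exact: proj2_sig.
Qed.

(** Infinitely many failures of [phi (x, e)] form a Morley subsequence. Continued by a Morley
    sequence over [e], where [phi] holds, it changes truth value once; [splice] places this change
    at every index and so yields an order. *)
Lemma average (n : nat) (A N : set M) (U : set_system ('I_n -> M)) c D (W : Type)
    (phi : formula L ('I_n + W)) (e : W -> M) :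
  UltraFilter U -> real U A c -> ~ order_property K A c ->
  small K N -> A `<=` N -> inv_over K U N -> morley U N D -> smallT K W ->
  U [set v | sat phi (jn v e)] -> exists k, forall i, (k <= i)%N -> sat phi (jn (D i) e).
Proof.
move=> uU rc stc sN AN iU hD sW Ue; apply: contrapT => nk; apply: stc.
have [|f fi fP] := @increasing_frequent (fun i => ~ sat phi (jn (D i) e)).
  move=> i; apply: contrapT => ni; apply: nk; exists i => j ij.
  by apply: contrapT => nj; apply: ni; exists j.
have sn := small_fin hK 'I_n.
have hDf := morley_comp fi hD.
have sDf : small K (range (flat (D \o f))).
  by apply: small_range; apply: small_prod => //; apply: small_nat.
have [D' hD'] := @morley_exists _ _ _ _ hM _ U ((N `|` range (flat (D \o f))) `|` range e)
  sn uU (small_setU hK (small_setU hK sN sDf) (small_range _ sW)).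
have [|rho [rhoN rhoD]] := splice hM sN sn iU hDf (D' := D').
  by apply: morley_sub hD'; apply: subsetUl.
have D'e i : sat phi (jn (D' i) e).
  by rewrite (real_sat (morley_real i hD')) // => w; right; exists w.
have DfE i j : sat phi (jn ((D \o f) i) (rho j \o e)) =
    sat phi (jn (if (i < j)%N then (D \o f) i else D' i) e).
  by rewrite -{1}(rhoD i j) -comp_jn sat_aut //; case: (rhoN j).
apply: (@order_property_opp _ _ _ _ _ _ _ phi (D \o f) (fun j => rho j \o e) sW).
  by move=> i; apply: real_eqv rc _; apply: real_sub (morley_real i hDf).
move=> i j; split=> ij; rewrite DfE; first by rewrite ij; apply: fP.
by rewrite ltnNge (ltnW ij); apply: D'e.
Qed.

(* Interleave realizations [c_i] of [U1] with Morley sequences [D_i] of [U2].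
   For [i < j] the truth value of [phi (c_i, D_j)] and of [phi (D_i 0, D_j)] is
   a constant [t0], so whatever [t0] is, one of the two families is ordered by
   [phi] if [U1] and [U2] disagree on [phi (x, D)]. *)
Lemma agreement (n : nat) (A N1 N2 : set M) (U1 U2 : set_system ('I_n -> M)) c D
    (phi : formula L ('I_n + (nat * 'I_n + {x | A x}))) :
  UltraFilter U1 -> UltraFilter U2 -> nondividing_ultra A U1 -> nondividing_ultra A U2 ->
  real U1 A c -> real U2 A c -> ~ order_property K A c ->
  small K N1 -> submodel N1 -> A `<=` N1 -> small K N2 -> submodel N2 -> A `<=` N2 ->
  morley U2 N2 D -> real U1 N1 (D 0) ->
  U2 [set v | sat phi (jn v (jn (flat D) (@vl _ _ A)))] ->
  U1 [set v | sat phi (jn v (jn (flat D) (@vl _ _ A)))].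
Proof.
move=> u1 u2 nd1 nd2 r1 r2 st s1 m1 A1 s2 m2 A2 hD D0 h2; apply: contrapT => h1; apply: (st).
have sA := small_sub A1 s1.
have sn := small_fin hK 'I_n.
have snn : smallT K (nat * 'I_n) by apply: small_prod => //; apply: small_nat.
have sW : smallT K (nat * 'I_n + {x | A x}).
  by apply: small_sum => //; apply: small_sig.
have i12 := nondividing_invariant u1 nd1 r1 st s2 m2 A2.
have i21 := nondividing_invariant u2 nd2 r2 st s1 m1 A1.
have i22 := nondividing_invariant u2 nd2 r2 st s2 m2 A2.
pose b (D : nat -> 'I_n -> M) := jn (flat D) (@vl _ _ A).
pose P (E : set M) (x : ('I_n -> M) * (nat -> 'I_n -> M)) :=
  real U1 E x.1 /\ morley U2 (E `|` range x.1) x.2.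
pose supp (x : ('I_n -> M) * (nat -> 'I_n -> M)) := range x.1 `|` range (flat x.2).
have [||E sE|x xP] := @small_sequence _ _ _ _ hM _ P supp (N1 `|` N2).
- exact: small_setU.
- by move=> x; apply: small_setU => //; apply: small_range.
- have [d rd] := real_exists u1 sE.
  have [G hG] := morley_exists hM sn u2 (small_setU hK sE (small_range d sn)).
  by exists (d, G).
pose E i := (N1 `|` N2) `|` [set y | exists2 j, (j < i)%N & supp (x j) y].
pose C i := (x i).1; pose G i := (x i).2.
have rC i : real U1 (E i) (C i) by case: (xP i).
have mG i : morley U2 (E i `|` range (C i)) (G i) by case: (xP i).
have N1E i : N1 `<=` E i by move=> y; left; left.
have N2E i : N2 `<=` E i by move=> y; left; right.
have AE i w : A w -> E i w by move=> /A1 /N1E.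
have CE i j : (i < j)%N -> range (C i) `<=` E j by move=> ij y h; right; exists i => //; left.
have GE i j : (i < j)%N -> range (flat (G i)) `<=` E j.
  by move=> ij y h; right; exists i => //; right.
have bE i j w : (i < j)%N -> E j (b (G i) w).
  by move=> ij; case: w => [p|[y Ay]]; [apply: (GE _ _ ij); exists p|apply: AE].
have rG i : real U2 (E i) (G i 0).
  by apply: real_sub (morley_real 0 (mG i)) => y; left.
have bG i : eqv N2 (b D) (b (G i)).
  apply: eqv_jn => [|[y Ay]]; last exact: A2.
  apply: (morley_eqv0 hM s2 sn i22 hD); apply: morley_sub (mG i) => y Ny.
  by left; apply: N2E.
(* Here [C i] realizes [U1] over [G j], which has the type of [D] over [N2]. So invariance of [U1]
   over the model belonging to [U2] is required. *)
have C_after i j : (j < i)%N -> ~ sat phi (jn (C i) (b (G j))).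
  move=> ji; rewrite (real_sat (rC i)); last by move=> w; apply: bE.
  by rewrite -(i12 _ phi _ _ sW (bG j)).
have G_after i j : (j < i)%N -> sat phi (jn (G i 0) (b (G j))).
  move=> ji; rewrite (real_sat (rG i)); last by move=> w; apply: bE.
  by rewrite -(i22 _ phi _ _ sW (bG j)).
have [D' hD'] := morley_exists hM sn u2
  (small_setU hK (small_setU hK s1 s2) (small_range (D 0) sn)).
(* For a Morley sequence taken over [N] and a point, the truth value depends only on the type of the
   point over [N]. Used over [N1] for [C i] and over [N2] for [G i 0], it compares both with the
   same point [D 0], which realizes [U1] over [N1] and [U2] over [N2]. *)
have before N (d e : 'I_n -> M) F F' : small K N -> A `<=` N -> inv_over K U2 N ->
    eqv N d e -> morley U2 (N `|` range d) F -> morley U2 (N `|` range e) F' ->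
    sat phi (jn d (b F)) = sat phi (jn e (b F')).
  move=> sN AN iN de hF hF'.
  have h := morley_eqv hM sN sn sn iN de hF hF'.
  pose f (u : 'I_n + (nat * 'I_n + {x | A x})) : ('I_n + nat * 'I_n) + {x | A x} :=
    match u with inl v => inl (inl v) | inr (inl p) => inl (inr p) | inr (inr q) => inr q end.
  have eq a H : jn a (b H) = jn (jn a (flat H)) (@vl _ _ A) \o f.
    by apply: funext => -[v|[p|q]].
  by rewrite !eq -!sat_ren; apply: (eqv_sat h) => -[y Ay]; apply: AN.
have C_before i j : (i < j)%N -> sat phi (jn (C i) (b (G j))) = sat phi (jn (D 0) (b D')).
  move=> ij; apply: (before N1) => //.
  - by apply: real_eqv D0; apply: real_sub (rC i); apply: N1E.
  - apply: morley_sub (mG j) => y [/N1E|/(CE _ _ ij)] h; by left.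
  - by apply: morley_sub hD' => y [Ny|h]; [left; left|right].
have G_before i j : (i < j)%N -> sat phi (jn (G i 0) (b (G j))) = sat phi (jn (D 0) (b D')).
  move=> ij; apply: (before N2) => //.
  - by apply: real_eqv (morley_real 0 hD); apply: real_sub (rG i); apply: N2E.
  - apply: morley_sub (mG j) => y [/N2E|[v _ <-]]; first by left.
    by left; apply: (GE _ _ ij); exists (0, v).
  - by apply: morley_sub hD' => y [Ny|h]; [left; right|right].
have [t0|nt0] := pselect (sat phi (jn (D 0) (b D'))).
  exists _, phi, C, (fun j => b (G j)); split=> // [i|i j].
    by apply: real_eqv r1 _; apply: real_sub (rC i) => w; apply: AE.
  by split=> ij; [rewrite C_before|apply: C_after].
apply: (@order_property_opp _ _ _ _ _ _ _ phi (fun i => G i 0) (fun j => b (G j)) sW).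
  by move=> i; apply: real_eqv r2 _; apply: real_sub (rG i) => w; apply: AE.
by move=> i j; split=> ij; [rewrite G_before|apply: G_after].
Qed.

(** Induction on initial segments. An automorphism [s] over [A] carries the earlier terms of [D1] to
    those of [D2], and replaces [U1] by [push s U1] and [N] by its image. [agreement] then shows
    that the moved type and [U2] treat these earlier terms alike. *)
Lemma morley_conjugate (n : nat) (A N : set M) (U1 U2 : set_system ('I_n -> M)) c D1 D2 :
  UltraFilter U1 -> UltraFilter U2 -> nondividing_ultra A U1 -> nondividing_ultra A U2 ->
  real U1 A c -> real U2 A c -> ~ order_property K A c ->
  small K N -> submodel N -> A `<=` N -> morley U1 N D1 -> morley U2 N D2 ->
  eqv A (flat D1) (flat D2).
Proof.
move=> u1 u2 nd1 nd2 r1 r2 st sN mN AN hD1 hD2.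
have sA := small_sub AN sN.
have i1 := nondividing_invariant u1 nd1 r1 st sN mN AN.
have sn := small_fin hK 'I_n.
pose cut k (D : nat -> 'I_n -> M) (p : 'I_k * 'I_n) := D p.1 p.2.
suff H k : eqv A (cut k D1) (cut k D2).
  have := @eqv_flat _ _ A _ void (@noW _ M) (@noW _ M) D1 D2.
  move=> /(_ _)/(eqv_comp inr); apply=> k.
  pose f (u : void + 'I_k * 'I_n) : 'I_k * 'I_n :=
    match u with inl v => match v with end | inr p => p end.
  have eq (D : nat -> 'I_n -> M) : jn (@noW _ M) (fun p : 'I_k * 'I_n => D p.1 p.2) = cut k D \o f.
    by apply: funext => -[[]|].
  by rewrite !eq; apply: eqv_comp.
case: k => [|k].
  by have -> : cut 0 D1 = cut 0 D2 by apply: funext => -[[]].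
(* The one-term case comes first: the inductive step needs [D2 0] to be the image of [D1 0], so that
   it realizes the moved type over the moved model. *)
elim: k => [|k IH].
  have eq D : cut 1 D = D 0 \o snd by apply: funext => -[i v]; rewrite /cut ord1.
  rewrite !eq; apply: eqv_comp; apply: (@eqv_trans _ _ _ _ c).
    by apply: real_eqv r1; apply: real_sub (morley_real 0 hD1).
  by apply: real_eqv r2 _; apply: real_sub (morley_real 0 hD2).
have sk m : smallT K ('I_m * 'I_n) by apply: small_prod => //; apply: small_fin.
have [s sE sD] := homogeneous hK hH sA (sk _) IH.
have as_ := sE.1.
apply: eqv_imp => phi.
pose f (u : 'I_k.+2 * 'I_n + {x | A x}) : 'I_n + ('I_k.+1 * 'I_n + {x | A x}) :=
  match u with
  | inl p => if unlift ord_max p.1 is Some j then inr (inl (j, p.2)) else inl p.2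
  | inr q => inr (inr q)
  end.
have eq D : jn (cut k.+2 D) (@vl _ _ A) = jn (D k.+1) (jn (cut k.+1 D) (@vl _ _ A)) \o f.
  apply: funext => -[[i v]|q] //=.
  by rewrite /cut /=; case: unliftP => [j|] -> //=; rewrite /bump leqNgt ltn_ord add0n.
have rk U D : morley U N D -> forall psi : formula L ('I_n + ('I_k.+1 * 'I_n + {x | A x})),
    sat psi (jn (D k.+1) (jn (cut k.+1 D) (@vl _ _ A))) =
    U [set v | sat psi (jn v (jn (cut k.+1 D) (@vl _ _ A)))].
  move=> hD psi; apply: (real_sat (hD k.+1)) => -[[j v]|[y Ay]]; last by left; apply: AN.
  by right; exists j => //; exists v.
rewrite !eq -!sat_ren (rk _ _ hD1) (rk _ _ hD2); set psi := ren phi f; move=> h1.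
have {h1}: push s U1 [set v | sat psi (jn v (jn (cut k.+1 D2) (@vl _ _ A)))].
  rewrite -sD; have -> : jn (s \o cut k.+1 D1) (@vl _ _ A) = s \o jn (cut k.+1 D1) (@vl _ _ A).
    by rewrite comp_jn; congr jn; apply: funext => -[y Ay] /=; rewrite (sE.2 _ Ay).
  by rewrite push_sat.
pose g : 'I_n + ('I_k.+1 * 'I_n + {x | A x}) -> 'I_n + (nat * 'I_n + {x | A x}) :=
  smap id (smap (fun p : 'I_k.+1 * 'I_n => (p.1 : nat, p.2)) id).
have geq v D : jn v (jn (cut k.+1 D) (@vl _ _ A)) = jn v (jn (flat D) (@vl _ _ A)) \o g.
  by rewrite !jn_smap.
have Ug (U : set_system ('I_n -> M)) D : U [set v | sat psi (jn v (jn (cut k.+1 D) (@vl _ _ A)))] =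
    U [set v | sat (ren psi g) (jn v (jn (flat D) (@vl _ _ A)))].
  by congr U; apply: eq_set => v; rewrite geq sat_ren.
rewrite !Ug => h1.
have pu1 := push_ultra s u1.
have pnd1 := push_nondividing u1 sA sE nd1.
have pr1 : real (push s U1) A c.
  have := push_real as_ r1.
  have -> : s @` A = A.
    apply/seteqP; split=> y; first by case=> z Az <-; rewrite sE.2.
    by move=> Ay; exists y => //; apply: sE.2.
  by apply: eqv_real; apply: aut_eqv.
have pN0 : real (push s U1) (s @` N) (D2 0).
  have -> : D2 0 = s \o D1 0.
    apply: funext => v; exact: esym (congr1 (fun h => h (ord0, v)) sD).
  by apply: push_real => //; apply: morley_real hD1.
have AsN : A `<=` s @` N by move=> y Ay; exists y; [apply: AN|apply: sE.2].
apply: contrapT; rewrite -ultra_setC => h2.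
have := @agreement _ A (s @` N) N (push s U1) U2 c D2 (fNot (ren psi g)) pu1 u2 pnd1 nd2 pr1 r2
  st (small_image _ sN) (submodel_aut as_ mN) AsN sN mN AN hD2 pN0 h2.
by move=> h3; have [v []] := filter_ex (filterI h1 h3).
Qed.

(** The automorphism carrying one Morley sequence to the other carries the averages along. A
    disagreement would be visible at any index beyond both thresholds given by [average]. *)
Theorem conjugate (n : nat) (A : set M) (U1 U2 : set_system ('I_n -> M)) c :
  UltraFilter U1 -> UltraFilter U2 -> nondividing_ultra A U1 -> nondividing_ultra A U2 ->
  small K A -> real U1 A c -> real U2 A c -> ~ order_property K A c ->
  exists2 s, aut_over A s & forall (W : Type) (phi : formula L ('I_n + W)) (e : W -> M),
    smallT K W -> U1 [set v | sat phi (jn v e)] -> U2 [set v | sat phi (jn v (s \o e))].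
Proof.
move=> u1 u2 nd1 nd2 sA r1 r2 st.
have [N [AN sN mN]] := submodel_exists hM sA.
have sn := small_fin hK 'I_n.
have [D1 hD1] := morley_exists hM sn u1 sN.
have [D2 hD2] := morley_exists hM sn u2 sN.
have snn : smallT K (nat * 'I_n) by apply: small_prod => //; apply: small_nat.
have [s sE sD] := homogeneous hK hH sA snn
  (morley_conjugate u1 u2 nd1 nd2 r1 r2 st sN mN AN hD1 hD2).
exists s => // W phi e sW h1; apply: contrapT; rewrite -ultra_setC => h2.
have i1 := nondividing_invariant u1 nd1 r1 st sN mN AN.
have i2 := nondividing_invariant u2 nd2 r2 st sN mN AN.
have [k1 k1P] := average u1 r1 st sN AN i1 hD1 sW h1.
have [k2 k2P] := average (phi := fNot phi) u2 r2 st sN AN i2 hD2 sW h2.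
suff h : sat phi (jn (D2 (maxn k1 k2)) (s \o e)) by exact: k2P (leq_maxr _ _) h.
have -> : D2 (maxn k1 k2) = s \o D1 (maxn k1 k2).
  apply: funext => v; exact: esym (congr1 (fun h => h (maxn k1 k2, v)) sD).
rewrite -comp_jn (sat_aut sE.1).
by apply: k1P; rewrite leq_maxl.
Qed.

End Conjugacy.

(** * Forking and ranks *)

Section Forking.
Variables (L : language) (T : set (sentence L)) (M : structure L) (K : Type).
Hypothesis hM : monster M K T.

Let hK : uncountable_strong_limit K. Proof. by case: hM. Qed.
Let hS : saturated M K. Proof. by case: hM. Qed.
Let hH : strongly_homogeneous M K. Proof. by case: hM. Qed.

Lemma complete_tp (n : nat) (A : set M) (c : 'I_n -> M) : complete_type A (tp A c).
Proof.
split; first by move=> psi [].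
  by move=> F _ Fc; exists c => psi /Fc [].
move=> psi o; have [h|h] := pselect (psat c psi); first by left; split.
by right; split.
Qed.

Lemma realized_complete (n : nat) (A : set M) (p : set (pformula M n)) c :
  complete_type A p -> realizes c p -> p = tp A c.
Proof.
move=> [pA _ pc] cp; apply/seteqP; split=> psi; first by move=> h; split; [apply: pA|apply: cp].
by move=> [o h]; have [//|/cp nh] := pc psi o.
Qed.

Lemma complete_realized (n : nat) (A : set M) (p : set (pformula M n)) :
  small K A -> complete_type A p -> exists c, p = tp A c.
Proof.
move=> sA cp; have [c hc] := hS sA cp; exists c; exact: realized_complete.
Qed.

Lemma tp_sub (n : nat) (A B : set M) (c : 'I_n -> M) : A `<=` B -> tp A c `<=` tp B c.
Proof. by move=> AB psi [o h]; split=> // j; apply: AB. Qed.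

Lemma eqv_realizes (n : nat) (B : set M) (c d : 'I_n -> M) : eqv B c d -> realizes d (tp B c).
Proof. by move=> /tp_eqv -> psi []. Qed.

Lemma realizes_eqv (n : nat) (B : set M) (c d : 'I_n -> M) : realizes d (tp B c) -> eqv B c d.
Proof. by move=> h; apply/tp_eqv; apply: realized_complete h; apply: complete_tp. Qed.

Definition parameters (n : nat) (D : set (pformula M n)) : set M :=
  \bigcup_(psi in D) range (par psi).

Lemma small_parameters (n : nat) (D : set (pformula M n)) :
  finite_set D -> small K (parameters D).
Proof.
move=> fD; apply: small_finset => //; apply: bigcup_finite => // psi _.
by apply: finite_image; apply: finite_finset.
Qed.

(** Nonforking says exactly that the type of [c] is finitely consistent with the negations of all
    formulas dividing over [A], so these generate a proper filter. *)
Lemma nonforking_ultra (n : nat) (A E : set M) (c : 'I_n -> M) : ~ forks A (tp E c) ->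
  exists U : set_system ('I_n -> M), [/\ UltraFilter U, nondividing_ultra A U & real U E c].
Proof.
move=> nf.
pose Q (D : set (pformula M n)) := finite_set D /\ forall psi, D psi -> divides A psi.
have Q0 : Q set0 by split=> // psi [].
pose I := ({phi : formula L ('I_n + {x | E x}) | sat phi (jn c (@vl _ _ E))} *
  {D | Q D})%type.
pose S (i : I) := [set v | sat (proj1_sig i.1) (jn v (@vl _ _ E)) /\
  forall psi, proj1_sig i.2 psi -> ~ psat v psi].
pose t0 : {phi : formula L ('I_n + {x | E x}) | sat phi (jn c (@vl _ _ E))} :=
  exist _ (ftrue L _) (sat_true _).
have PF : ProperFilter (filter_from setT S).
  apply: filter_from_proper => [|[[phi cphi] [D [fD dD]]] _]; last first.
    apply: contrapT => nv; apply: nf; exists D; split=> // d dc.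
    apply: contrapT => nd; apply: nv; exists d; split=> [|psi Dpsi hpsi] /=.
      by rewrite -(realizes_eqv dc).
    by apply: nd; exists psi.
  apply: filter_from_filter; first by exists (t0, exist Q set0 Q0).
  move=> [[phi cphi] [D [fD dD]]] [[phi' cphi'] [D' [fD' dD']]] _ _.
  have hD : Q (D `|` D').
    by split=> [|psi [/dD|/dD']//]; rewrite finite_setU.
  exists (exist (fun phi => sat phi (jn c (@vl _ _ E))) (fAnd phi phi') (conj cphi cphi'),
    exist Q _ hD) => //.
  move=> v [[/= h1 h2] h3]; split; split=> //= psi Dpsi; apply: h3 => /=; first by left.
  by right.
have [U [uU SU]] := ultraFilterLemma PF; exists U; split=> //.
  move=> psi dv hpsi.
  have hD : Q [set psi].
    by split=> [|_ ->//]; apply: finite_set1.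
  have hn : U (S (t0, exist Q _ hD)) by apply: SU; exists (t0, exist Q _ hD).
  by have [v [h [_ /(_ psi erefl)]]] := filter_ex (filterI hpsi hn).
have imp (phi : formula L ('I_n + {x | E x})) : sat phi (jn c (@vl _ _ E)) ->
    U [set v | sat phi (jn v (@vl _ _ E))].
  move=> h; apply: SU; exists (exist (fun phi => sat phi (jn c (@vl _ _ E))) phi h,
    exist Q set0 Q0) => //.
  by move=> v [].
move=> phi; apply/propext; split=> [/imp //|h].
apply: contrapT => nh; have /imp h' : sat (fNot phi) (jn c (@vl _ _ E)) by [].
by have [v []] := filter_ex (filterI h h').
Qed.

Lemma nonforking_extension (n : nat) (A B B' : set M) (c : 'I_n -> M) :
  small K B' -> B `<=` B' -> ~ forks A (tp B c) ->
  exists2 c', eqv B c c' & ~ forks A (tp B' c').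
Proof.
move=> sB' BB' /nonforking_ultra[U [uU ndU rc]].
have [c' rc'] := real_exists hM uU sB'; exists c'.
  by apply: real_eqv rc _; apply: real_sub rc'.
(* The formulas of [D] may have parameters outside [B'], so [U] is realized over these too; that
   realization would satisfy a dividing formula. *)
move=> [D [fD dD hD]].
have sD := small_parameters fD.
have [d rd] := real_exists hM uU (small_setU hK sB' sD).
have [|psi Dpsi hpsi] := hD d.
  by apply: eqv_realizes; apply: real_eqv rc' _; apply: real_sub rd; apply: subsetUl.
apply: (nondividing_real ndU rd _ hpsi (dD _ Dpsi)) => j.
by right; exists psi => //; exists j.
Qed.

Lemma conj_tp (n : nat) (A : set M) (c : 'I_n -> M) (g : M -> M) : automorphism g ->
  conj_type g (tp A c) = tp (g @` A) (g \o c).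
Proof.
move=> ag; have [h [ah gh hg]] := aut_inv ag.
have cpfE (psi : pformula M n) : PFormula (pfml psi) (g \o par psi) = cpf g psi by [].
apply/seteqP; split=> psi.
  move=> [chi [o hc] <-]; rewrite cpfE; split; last by rewrite psat_cpf.
  by move=> j; exists (par chi j).
move=> [o hc].
have E : cpf g (cpf h psi) = psi.
  case: psi {o hc} => l f p; rewrite /cpf /=; congr PFormula.
  by apply: funext => j /=; rewrite hg.
exists (cpf h psi); last by rewrite -[RHS]E.
split; last by rewrite -(psat_cpf _ _ ag) E.
by move=> j /=; have [y Ay <-] := o j; rewrite gh.
Qed.

(** This makes inconsistency of [k] instances a first-order property of the parameters, which
    [directed_realized] can transfer to a limit. *)
Lemma kinconsistent_formula (k n l : nat) (phi : formula L ('I_n + 'I_l)) :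
  exists theta : formula L ('I_k * 'I_l), forall y : 'I_k -> 'I_l -> M,
    sat theta (fun p => y p.1 p.2) = exists c, forall j, sat phi (jn c (y j)).
Proof.
have [all allP] := forall_index M
  (fun j : 'I_k => ren phi (smap (@id 'I_n) (fun i : 'I_l => (j, i)))).
have [theta thetaP] := exists_tuple M all; exists theta => y; rewrite thetaP.
congr ex; apply: funext => c; rewrite allP; apply/propext.
by split=> h j; have := h j; rewrite sat_ren jn_smap.
Qed.

End Forking.

(** * Ranks with bounded multiplicity and extension *)

Section Ranks.
Variables (L : language) (T : set (sentence L)) (M : structure L) (K : Type).
Hypothesis hM : monster M K T.
Variable C : forall n : nat, set (set (pformula M n)).
Hypothesis hC : type_class K C.
Variables (d : Order.disp_t) (W : orderType d).
Hypothesis hW : well_founded (fun x y : W => (x < y)%O).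
Variable R : forall n : nat, set (pformula M n) -> option W.
Hypothesis hR : is_rank C R.

Let hK : uncountable_strong_limit K. Proof. by case: hM. Qed.
Let hS : saturated M K. Proof. by case: hM. Qed.
Let hH : strongly_homogeneous M K. Proof. by case: hM. Qed.

Lemma rank_le_anti (a b : option W) : rank_le a b -> rank_le b a -> a = b.
Proof.
case: a b => [x|] [y|] //= xy yx; congr Some.
by apply: Order.POrderTheory.le_anti; rewrite xy yx.
Qed.

Lemma class_extension (n : nat) (A B : set M) (c : 'I_n -> M) :
  C (tp A c) -> small K B -> A `<=` B -> C (tp B c).
Proof.
case: hC => _ h _ Cc sB AB; apply: h Cc sB (complete_tp _ _) _.
exact: tp_sub.
Qed.

Lemma heredity (n : nat) (A B : set M) (c : 'I_n -> M) :
  C (tp A c) -> small K B -> A `<=` B -> rank_le (R (tp B c)) (R (tp A c)).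
Proof.
case: hR => h _ Cc sB AB; apply: h => //; last exact: tp_sub.
exact: class_extension AB.
Qed.

Lemma rank_aut (n : nat) (A : set M) (c : 'I_n -> M) g :
  C (tp A c) -> automorphism g -> R (tp A c) = R (tp (g @` A) (g \o c)).
Proof. by case: hR => _ h Cc ag; rewrite (h _ _ _ Cc ag) conj_tp. Qed.

Lemma rank_extension (n : nat) (A B : set M) (c : 'I_n -> M) : extension K C R ->
  small K A -> C (tp A c) -> ranked R (tp A c) -> small K B -> A `<=` B ->
  exists2 c', eqv A c c' & R (tp B c') = R (tp A c).
Proof.
move=> hE sA Cc rc sB AB.
have [q [cq pq Rq]] := hE n A (tp A c) sA (complete_tp _ _) Cc rc B sB AB.
have [c' qc'] := complete_realized hM sB cq; rewrite qc' in pq Rq.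
by exists c' => //; apply: realizes_eqv => psi /pq [].
Qed.

Lemma rank_between (n : nat) (A B E : set M) (c : 'I_n -> M) :
  C (tp A c) -> small K B -> small K E -> A `<=` B -> B `<=` E ->
  R (tp E c) = R (tp A c) -> R (tp B c) = R (tp A c).
Proof.
move=> Cc sB sE AB BE e; apply: rank_le_anti; first exact: heredity.
by rewrite -e; apply: heredity => //; apply: class_extension AB.
Qed.

Hypothesis hB : bounded_multiplicity K C R.

Lemma nat_ultra : exists w : set_system nat,
  UltraFilter w /\ forall k, w [set i | (k <= i)%N].
Proof.
pose S k := [set i | (k <= i)%N].
have PF : ProperFilter (filter_from setT S).
  by apply: filter_from_proper => k _; exists k; rewrite /S /=.
have [w [uw Sw]] := ultraFilterLemma PF; exists w; split=> // k.
by apply: Sw; exists k.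
Qed.

Lemma ultra_increasing (w : set_system nat) (Z : set nat) : UltraFilter w ->
  (forall k, w [set i | (k <= i)%N]) -> w Z -> exists2 f, increasing f & forall i, Z (f i).
Proof.
move=> uw hw wZ; apply: increasing_frequent => i.
by have [j [Zj ij]] := filter_ex (filterI wZ (hw i)); exists j.
Qed.

(** The position of [a] is the number of elements of [s] below it; if [a] lies in [s] and below [b],
    it is counted for [b] but not for itself. *)
Lemma finite_position (I : Type) (lt : I -> I -> Prop) (s : seq {classic I}) :
  (forall x, ~ lt x x) -> (forall x y z, lt x y -> lt y z -> lt x z) ->
  exists r : I -> nat, forall a b, (a : {classic I}) \in s -> lt a b -> (r a < r b)%N.
Proof.
move=> irr tr; exists (fun a => count (fun b => `[< lt b a >]) s) => a b sa ab.
have [e1 e2] : count (pred1 (a : {classic I})) s > 0 /\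
    count (predI (fun b => `[< lt b a >]) (pred1 (a : {classic I}))) s = 0.
  split; first by rewrite -has_count has_pred1.
  rewrite (eq_count (a2 := pred0)) ?count_pred0 // => x /=.
  by apply/negP => /andP[/asboolP h /eqP e]; apply: (irr a); rewrite -{1}e.
have := count_predUI (fun b => `[< lt b a >]) (pred1 (a : {classic I})) s.
rewrite e2 addn0 => e.
have : (count (predU (fun b => `[< lt b a >]) (pred1 (a : {classic I}))) s <=
    count (fun c => `[< lt c b >]) s)%N.
  apply: sub_count => x /orP[/asboolP h|/eqP ->]; apply/asboolP => //.
  exact: tr h ab.
by rewrite e; apply: leq_trans; rewrite -addn1 leq_add2l.
Qed.

(* An order property indexed by a linear order with more than [kappa] cuts makes
   more than [kappa] extensions of the type unstable; by induction these keep the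
   rank. *)
Lemma ranked_stable (a : W) (n : nat) (A : set M) (c : 'I_n -> M) :
  small K A -> C (tp A c) -> R (tp A c) = Some a -> ~ order_property K A c.
Proof.
elim: a / (hW a) n A c => a _ IH n A c sA Cc Ra [W0 [phi [cs [bs [sW0 hcs hord]]]]].
have [kappa skappa hk] := hB sA (complete_tp A c) Cc (ltac:(by rewrite /ranked Ra)).
(* The bound [kappa] depends on the type over [A] alone, so it can be exceeded before [B] is
   chosen. *)
pose X := set {x | kappa x}.
have sX : smallT K X by apply: small_set => //; apply: small_sig.
have [lt [irr tr tot]] := linear_order X.
(* Each point of [X] becomes an infinite block: the limit of a block gives one extension, and the
   order inside the block keeps it unstable. *)
pose I := (X * nat)%type.
pose ltI (u v : I) := lt u.1 v.1 \/ (u.1 = v.1 /\ (u.2 < v.2)%N).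
have irrI u : ~ ltI u u by case=> [/irr//|[_]]; rewrite ltnn.
have trI u v w : ltI u v -> ltI v w -> ltI u w.
  move=> [h1|[e1 h1]] [h2|[e2 h2]].
  - by left; apply: tr h1 h2.
  - by left; rewrite -e2.
  - by left; rewrite e1.
  - by right; split; [rewrite e1|apply: ltn_trans h1 h2].
have sI : smallT K I by apply: small_prod => //; apply: small_nat.
have sV (J : Type) : smallT K J -> smallT K (J * 'I_n + J * W0).
  move=> sJ; apply: small_sum => //; apply: small_prod => //; exact: small_fin.
pose mk (r : I -> nat) : I * 'I_n + I * W0 -> M :=
  jn (fun p => cs (r p.1) p.2) (fun p => bs (r p.1) p.2).
pose S (s : seq {classic I}) := [set v | exists2 r : I -> nat,
  (forall u v, (u : {classic I}) \in s -> ltI u v -> (r u < r v)%N) & v = mk r].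
have [||v0 v0P] := @directed_realized _ _ K _ (ultra_realized_small hK hS (sV I sI)) A
  (seq {classic I}) [::] S sA.
- by move=> s; have [r rP] := finite_position s irrI trI; exists (mk r); exists r.
- move=> s s'; exists (s ++ s') => v [r rP ->]; split; exists r => // x y xs; apply: rP;
    by rewrite mem_cat xs ?orbT.
pose ci (u : I) (i : 'I_n) := v0 (inl (u, i)).
pose bi (u : I) (w : W0) := v0 (inr (u, w)).
have eqc u : eqv A c (ci u).
  apply: eqv_imp => th hth.
  pose f (t : 'I_n + {x | A x}) : (I * 'I_n + I * W0) + {x | A x} :=
    match t with inl i => inl (inl (u, i)) | inr q => inr q end.
  have e v : jn (fun i => v (inl (u, i))) (@vl _ _ A) = jn v (@vl _ _ A) \o f.
    by apply: funext => -[].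
  rewrite /ci e -sat_ren; apply: v0P; exists [::] => v [r _ ->].
  rewrite sat_ren -e; have -> : (fun i => mk r (inl (u, i))) = cs (r u) by apply: funext.
  by rewrite -hcs.
have ord u v : (ltI u v -> sat phi (jn (ci u) (bi v))) /\
               (ltI v u -> ~ sat phi (jn (ci u) (bi v))).
  pose f (t : 'I_n + W0) : (I * 'I_n + I * W0) + {x | A x} :=
    match t with inl i => inl (inl (u, i)) | inr w => inl (inr (v, w)) end.
  have e z : jn (fun i => z (inl (u, i))) (fun w => z (inr (v, w))) = jn z (@vl _ _ A) \o f.
    by apply: funext => -[].
  have e' r : sat (ren phi f) (jn (mk r) (@vl _ _ A)) = sat phi (jn (cs (r u)) (bs (r v))).
    rewrite sat_ren -e; congr sat; by apply: funext => -[].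
  split=> uv; rewrite /ci /bi e -sat_ren.
    apply: v0P; exists [:: u : {classic I}] => z [r rP ->]; rewrite e'.
    by apply: (hord _ _).1; apply: rP => //; apply: mem_head.
  apply: (v0P (fNot (ren phi f))); exists [:: v : {classic I}] => z [r rP ->].
  rewrite /= e'; apply: (hord _ _).2; apply: rP => //; exact: mem_head.
(* The first parameter of each block suffices to separate blocks: [phi] with [bi (y, 0)] holds on
   earlier blocks and fails on the block of [y] after its first term. *)
pose B := A `|` range (fun p : X * W0 => bi (p.1, 0) p.2).
have sB : small K B.
  by apply: small_setU => //; apply: small_range; apply: small_prod.
have AB : A `<=` B by apply: subsetUl.
have [w [uw hw]] := nat_ultra.
(* [dx x] realizes the limit over [B] of the block of [x] along [w]. Subsequences of the block
   inside sets of [w] approximate an ordered sequence all of whose terms realize this limit. *)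
have /choice[dx dxP] : forall x : X, exists dx,
    (forall th : formula L ('I_n + {y | B y}),
      w [set z | sat th (jn (ci (x, z)) (@vl _ _ B))] -> sat th (jn dx (@vl _ _ B))) /\
    order_property K B dx.
  move=> x.
  pose mk' (f : nat -> nat) : nat * 'I_n + nat * W0 -> M :=
    jn (fun p => ci (x, f p.1) p.2) (fun p => bi (x, f p.1) p.2).
  pose S' (Z : {Z | w Z}) := [set v | exists2 f,
    increasing f /\ (forall i, proj1_sig Z (f i)) & v = mk' f].
  have [||v1 v1P] := @directed_realized _ _ K _ (ultra_realized_small hK hS (sV nat (small_nat hK)))
    B {Z | w Z} (exist _ setT (filterT)) S' sB.
  - move=> [Z wZ]; have [f fi fZ] := ultra_increasing uw hw wZ.
    by exists (mk' f); exists f.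
  - move=> [Z wZ] [Z' wZ']; exists (exist _ _ (filterI wZ wZ')) => v [f [fi fZ] ->].
    by split; exists f => //; split=> // i; have [] := fZ i.
  pose ck k (i : 'I_n) := v1 (inl (k, i)); pose bk k (y : W0) := v1 (inr (k, y)).
  have ckP k (th : formula L ('I_n + {y | B y})) :
      w [set z | sat th (jn (ci (x, z)) (@vl _ _ B))] -> sat th (jn (ck k) (@vl _ _ B)).
    move=> wZ.
    pose f (t : 'I_n + {y | B y}) : (nat * 'I_n + nat * W0) + {y | B y} :=
      match t with inl i => inl (inl (k, i)) | inr q => inr q end.
    have e v : jn (fun i => v (inl (k, i))) (@vl _ _ B) = jn v (@vl _ _ B) \o f.
      by apply: funext => -[].
    rewrite /ck e -sat_ren; apply: v1P; exists (exist _ _ wZ) => v [g [_ gZ] ->].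
    rewrite sat_ren -e; have -> : (fun i => mk' g (inl (k, i))) = ci (x, g k) by apply: funext.
    exact: gZ.
  exists (ck 0); split; first exact: ckP.
  exists W0, phi, ck, bk; split=> // [k|i j].
    apply: eqv_imp => th; apply: contraPP => h0 h1.
    have : sat (fNot th) (jn (ck 0) (@vl _ _ B)).
      apply: (ckP 0); rewrite /= ultra_setC => /(ckP k); exact: h0.
    by move=> /(_ h1).
  pose f (t : 'I_n + W0) : (nat * 'I_n + nat * W0) + {y | B y} :=
    match t with inl v => inl (inl (i, v)) | inr y => inl (inr (j, y)) end.
  have e z : jn (fun v => z (inl (i, v))) (fun y => z (inr (j, y))) = jn z (@vl _ _ B) \o f.
    by apply: funext => -[].
  have e' g : sat (ren phi f) (jn (mk' g) (@vl _ _ B)) = sat phi (jn (ci (x, g i)) (bi (x, g j))).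
    rewrite sat_ren -e; congr sat; by apply: funext => -[].
  split=> ij; rewrite /ck /bk e -sat_ren.
    apply: v1P; exists (exist _ setT filterT) => z [g [gi _] ->]; rewrite e'.
    by apply: (ord _ _).1; right; split=> //; apply: gi.
  apply: (v1P (fNot (ren phi f))); exists (exist _ setT filterT) => z [g [gi _] ->].
  rewrite /= e'; apply: (ord _ _).2; right; split=> //; exact: gi.
have dxA x : eqv A c (dx x).
  apply: eqv_imp => th hth; have [|th' thP] := @sat_parameters _ _ B 'I_n _ (@vl _ _ A) th.
    by move=> [y Ay]; left.
  rewrite thP; apply: (dxP x).1; apply: filterS (@filterT _ w _) => z _ /=.
  by rewrite -thP -eqc.
(* Heredity gives one inequality; a smaller rank would make [dx x] stable over [B] by induction. *)
have dxR x : R (tp B (dx x)) = R (tp A c).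
  have cA : tp A c = tp A (dx x) by apply/tp_eqv.
  have CA : C (tp A (dx x)) by rewrite -cA.
  have := heredity CA sB AB; rewrite -cA Ra.
  case E : (R (tp B (dx x))) => [b|] //= ba.
  congr Some; apply/eqP; apply: contrapT => /negP nab.
  apply: (IH b _ n B (dx x) sB (class_extension CA sB AB) E (dxP x).2).
  by rewrite Order.POrderTheory.lt_neqAle nab ba.
have dxI x y : lt x y -> tp B (dx x) = tp B (dx y) -> False.
  move=> xy /tp_eqv h.
  pose e := bi (y, 0).
  have Be z : B (e z) by right; exists (y, z).
  have [th thP] := sat_parameters phi Be.
  have h1 : sat th (jn (dx x) (@vl _ _ B)).
    apply: (dxP x).1; apply: filterS (@filterT _ w _) => z _ /=.
    by rewrite -thP; apply: (ord _ _).1; left.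
  have : sat (fNot th) (jn (dx y) (@vl _ _ B)).
    (* Index [0] is avoided because the diagonal of the order property is unspecified. *)
    apply: (dxP y).1; apply: filterS (hw 1) => z z0 /=.
    by rewrite -thP; apply: (ord _ _).2; right.
  by rewrite /= -h.
have inj_dx : injective (fun x => tp B (dx x)).
  move=> x y e; apply: contrapT => /tot[] xy; first exact: dxI xy e.
  by apply: dxI xy (esym e).
have le : [set: X] #<= kappa.
  apply: card_le_trans (hk B sB AB).
  have e : (fun x => tp B (dx x)) @` [set: X] #= [set: X].
    by apply: inj_card_eq => x y _ _; apply: inj_dx.
  rewrite -(card_le_eql e); apply: subset_card_le => _ [x _ <-]; split.
  - exact: complete_tp.
  - by have /tp_eqv -> := dxA x; apply: tp_sub.
  - exact: dxR.
move: le; rewrite (card_le_eqr (card_eq_sig kappa)) => /card_leTTP[f fI].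
exact: cantor fI.
Qed.

Hypothesis hE : extension K C R.

(* A sequence witnessing dividing stretches to one longer than the multiplicity
   bound; each of its formulas has an extension of full rank, so too many of them
   lie in one and the same type. *)
Lemma same_rank_nondividing (n : nat) (A B : set M) (c : 'I_n -> M) :
  small K A -> small K B -> A `<=` B -> C (tp A c) -> ranked R (tp A c) ->
  R (tp B c) = R (tp A c) -> nondividing_over A B c.
Proof.
move=> sA sB AB Cc rc RB psi o hpsi /(divides_aut hM sA)[k [g [gA gk]]].
have [kappa skappa hk] := hB sA (complete_tp A c) Cc rc.
(* A map from [X] to [kappa] with finite fibres would inject [X] into [kappa] times [nat]; taking
   the power set of that product forbids it. *)
pose X := set ({x | kappa x} * nat).
have sX : smallT K X.
  by apply: small_set => //; apply: small_prod => //; [apply: small_sig|apply: small_nat].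
(* Inconsistency of the empty family is impossible, since every point satisfies it. *)
case: k gk => [|k] gk.
  have i0 : 'I_0 -> nat by move=> i; exact: i.
  have i0I : injective i0 by case.
  by case: (gk i0 i0I); exists c; case.
pose V := (X * 'I_(plen psi))%type.
have sV : smallT K V by apply: small_prod => //; apply: small_fin.
pose mk (r : X -> nat) : V -> M := fun p => g (r p.1) (par psi p.2).
pose S (s : seq {classic X}) := [set v | exists2 r : X -> nat,
  (forall x y, (x : {classic X}) \in s -> (y : {classic X}) \in s -> r x = r y -> x = y) &
  v = mk r].
have [||v0 v0P] := @directed_realized _ _ K _ (ultra_realized_small hK hS sV) A
  (seq {classic X}) [::] S sA.
- move=> s; pose r (x : X) := index (x : {classic X}) s.
  by exists (mk r); exists r => // x y xs ys; apply: index_inj.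
- move=> s s'; exists (s ++ s') => v [r rP ->]; split; exists r => // x y xs ys; apply: rP;
    by rewrite mem_cat ?xs ?ys ?orbT.
pose b (x : X) (j : 'I_(plen psi)) := v0 (x, j).
have bA x : eqv A (par psi) (b x).
  apply: eqv_imp => th hth.
  pose f (t : 'I_(plen psi) + {x | A x}) : V + {x | A x} :=
    match t with inl i => inl (x, i) | inr q => inr q end.
  have e v : jn (fun i => v (x, i)) (@vl _ _ A) = jn v (@vl _ _ A) \o f.
    by apply: funext => -[].
  rewrite /b e -sat_ren; apply: v0P; exists [::] => v [r _ ->].
  rewrite sat_ren -e; have -> : (fun i => mk r (x, i)) = g (r x) \o par psi by [].
  by rewrite (aut_eqv _ (gA _)).
have binc (i : 'I_k.+1 -> X) : injective i ->
    ~ exists e, forall l, sat (pfml psi) (jn e (b (i l))).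
  move=> iI; have [theta thetaP] := kinconsistent_formula M k.+1 (pfml psi).
  rewrite -(thetaP (fun l => b (i l))).
  pose f (t : 'I_k.+1 * 'I_(plen psi)) : V + {x | A x} := inl (i t.1, t.2).
  have -> : (fun p => b (i p.1) p.2) = jn v0 (@vl _ _ A) \o f by [].
  rewrite -sat_ren.
  apply: (v0P (fNot (ren theta f))); exists (codom i : seq {classic X}) => v [r rP ->].
  rewrite /= sat_ren.
  have -> : jn (mk r) (@vl _ _ A) \o f = (fun p => (fun l j => g (r (i l)) (par psi j)) p.1 p.2).
    by apply: funext.
  rewrite (thetaP (fun l j => g (r (i l)) (par psi j))) => -[e eP].
  apply: (gk (fun l => r (i l))); last by exists e => l; apply: eP.
  by move=> l l' /rP h; apply: iI; apply: h; apply: codom_f.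
pose E := A `|` range v0.
have sE : small K E by apply: small_setU => //; apply: small_range.
(* Conjugating [c] so that the parameters of [psi] become [b x] preserves the rank over these
   parameters; Extension then carries the type to all of [E] without loss of rank. *)
have /choice[cx cxP] : forall x : X, exists cx,
    [/\ eqv A c cx, R (tp E cx) = R (tp A c) & sat (pfml psi) (jn cx (b x))].
  move=> x; have [s sA' sb] := homogeneous hK hH sA (small_fin hK _) (bA x).
  pose F := A `|` range (par psi).
  have sF : small K F by apply: small_setU => //; apply: small_range; apply: small_fin.
  have AF : A `<=` F by apply: subsetUl.
  have FB : F `<=` B by move=> y [/AB//|[j _ <-]]; apply: o.
  have RF := rank_between Cc sF sB AF FB RB.
  have CF := class_extension Cc sF AF.
  have Rs := rank_aut CF sA'.1.
  have AsF : A `<=` s @` F by move=> y Ay; exists y; [left|apply: sA'.2].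
  have cAs : tp A c = tp A (s \o c) by apply/tp_eqv; apply: eqv_sym; apply: aut_eqv.
  have ssF : small K (s @` F) by apply: small_image.
  have CsF : C (tp (s @` F) (s \o c)) by apply: class_extension AsF; rewrite -?cAs.
  have sFE : s @` F `<=` E.
    move=> _ [y [Ay|[j _ <-]] <-]; first by left; rewrite sA'.2.
    by right; exists (x, j) => //; rewrite -[RHS]/((s \o par psi) j) sb.
  have [|cx ecx Rcx] := rank_extension hE ssF CsF _ sE sFE; first by rewrite /ranked -Rs RF.
  exists cx; split.
  - apply: eqv_trans (eqv_sub AsF ecx); apply: eqv_sym; exact: aut_eqv.
  - by rewrite Rcx -Rs RF.
  - have bF j : (s @` F) (b x j).
      by exists (par psi j); [right; exists j|rewrite -[LHS]/((s \o par psi) j) sb].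
    rewrite -(eqv_sat ecx bF) -sb -comp_jn (sat_aut sA'.1).
    exact: hpsi.
have [h hP] : exists h : X -> {x | kappa x}, forall x y, h x = h y -> tp E (cx x) = tp E (cx y).
  have AE : A `<=` E by apply: subsetUl.
  have := hk E sE AE; set Q := [set q | _] => hQ.
  have : [set: {q | Q q}] #<= [set: {x | kappa x}].
    by rewrite -(card_le_eql (card_eq_sig Q)) -(card_le_eqr (card_eq_sig kappa)).
  move=> /card_leTTP[f fI].
  have Qx x : Q (tp E (cx x)).
    have [h1 h2 _] := cxP x; split=> //; first exact: complete_tp.
    by have /tp_eqv -> := h1; apply: tp_sub.
  by exists (fun x => f (exist _ _ (Qx x))) => x y /fI [].
(* On a fibre all [cx x] have one type over [E], so a single point satisfies all its instances;
   [binc] forbids [k.+1] of them. *)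
have fin u : finite_set [set x | h x = u].
  apply: contrapT => /infiniteP; rewrite (card_le_eqr (card_eq_sig _)) => /card_leTTP[f fI].
  pose i (l : 'I_k.+1) := proj1_sig (f l).
  have iI : injective i by move=> l l' /sig_inj /fI /ord_inj.
  apply: (binc i iI); exists (cx (i ord0)) => l.
  have [_ _ hl] := cxP (i l).
  have /hP/tp_eqv e : h (i ord0) = h (i l).
    by rewrite /i (proj2_sig (f ord0)) (proj2_sig (f l)).
  by rewrite (eqv_sat e) // => j; right; exists (i l, j).
have /choice[num numP] : forall u, exists f : X -> nat,
    forall x y, h x = u -> h y = u -> f x = f y -> x = y.
  move=> u; have /finite_set_countable/countable_injP[f fI] := fin u.
  by exists f => x y hx hy; apply: fI; rewrite inE.
apply: (cantor (f := fun x : X => (h x, num (h x) x))) => x y [e1 e2].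
apply: (numP (h x)) => //; by rewrite e2 e1.
Qed.

Lemma same_rank_nonforking (n : nat) (A B : set M) (c : 'I_n -> M) :
  small K A -> small K B -> A `<=` B -> C (tp A c) -> ranked R (tp A c) ->
  R (tp B c) = R (tp A c) -> ~ forks A (tp B c).
Proof.
move=> sA sB AB Cc rc RB [D [fD dD hD]].
have sD := small_parameters hM fD.
have sE := small_setU hK sB sD.
have BD : B `<=` B `|` parameters D by apply: subsetUl.
have rB : ranked R (tp B c) by rewrite /ranked RB.
have [c' cc' Rc'] := rank_extension hE sB (class_extension Cc sB AB) rB sE BD.
have [|psi Dpsi hpsi] := hD c'; first exact: eqv_realizes.
have cA : tp A c = tp A c' by apply/tp_eqv; apply: eqv_sub cc'.
have Ac' : C (tp A c') by rewrite -cA.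
apply: (@same_rank_nondividing n A (B `|` parameters D) c' sA sE _ Ac' _ _ psi _ hpsi (dD _ Dpsi)).
- by move=> y /AB; left.
- by rewrite /ranked -cA.
- by rewrite Rc' RB cA.
- by move=> j; right; exists psi => //; exists j.
Qed.

(** The rank is computed after conjugation: [s] carries a global extension [U2] of the type over [B]
    to [U1], which comes from a full-rank extension to the model [N]. *)
Theorem nonforking_same_rank (n : nat) (A B : set M) (c : 'I_n -> M) :
  small K A -> small K B -> A `<=` B -> C (tp A c) -> ranked R (tp A c) ->
  ~ forks A (tp B c) -> R (tp B c) = R (tp A c).
Proof.
move=> sA sB AB Cc rc nf.
have st : ~ order_property K A c.
  case E : (R (tp A c)) => [a|]; last by case: rc.
  exact: ranked_stable E.
have [N [AN sN mN]] := submodel_exists hM sA.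
have [c1 ec1 Rc1] := rank_extension hE sA Cc rc sN AN.
have cA1 : tp A c = tp A c1 by apply/tp_eqv.
have CA1 : C (tp A c1) by rewrite -cA1.
have rA1 : ranked R (tp A c1) by rewrite /ranked -cA1.
have RN1 : R (tp N c1) = R (tp A c1) by rewrite Rc1 cA1.
have CN1 := class_extension CA1 sN AN.
have [U1 [u1 nd1 r1]] := nonforking_ultra (same_rank_nonforking sA sN AN CA1 rA1 RN1).
have [U2 [u2 nd2 r2]] := nonforking_ultra nf.
have r1A : real U1 A c by apply: eqv_real (eqv_sym ec1) _; apply: real_sub r1.
have [s sA' sP] := conjugate hM u2 u1 nd2 nd1 sA (real_sub AB r2) r1A st.
have ssB : small K (s @` B) by apply: small_image.
have sE := small_setU hK sN ssB.
have [e re] := real_exists hM u1 sE.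
have NE : N `<=` N `|` s @` B by apply: subsetUl.
have [c2 ec2 Rc2] : exists2 c2, eqv N c1 c2 & R (tp (N `|` s @` B) c2) = R (tp N c1).
  by apply: rank_extension; rewrite // /ranked RN1.
have cA2 : tp A c1 = tp A c2 by apply/tp_eqv; apply: eqv_sub ec2.
have st1 : ~ order_property K A c1 by apply: contra_not st; apply: order_property_eqv.
have AE : A `<=` N `|` s @` B by move=> y /AN; left.
(* Full rank makes [c2] nondividing over [A], so uniqueness over [N] identifies its type with that
   of [e], which thereby inherits the rank. *)
have e12 : eqv (N `|` s @` B) c2 e.
  apply: (nondividing_unique hM _ sN mN AN NE).
  - by apply: contra_not st1; apply: order_property_eqv; apply: eqv_sub ec2.
  - apply: eqv_trans (eqv_sym ec2) _; apply: real_eqv r1 _; exact: real_sub re.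
  - apply: (same_rank_nondividing sA sE AE); rewrite -?cA2 // /ranked.
    by rewrite Rc2.
  - exact: nondividing_real nd1 re.
have ce : tp A c = tp A e by rewrite cA1 cA2; apply/tp_eqv; apply: eqv_sub e12.
have Ce : C (tp A e) by rewrite -ce.
have AsB : A `<=` s @` B by move=> y Ay; exists y; [apply: AB|apply: sA'.2].
have Re : R (tp (s @` B) e) = R (tp A e).
  apply: (rank_between Ce ssB sE AsB) => [y|]; first by right.
  by rewrite -ce -(proj2 (tp_eqv _ _ _) e12) Rc2 RN1 cA1.
rewrite (rank_aut (class_extension Cc sB AB) sA'.1) ce -Re; congr R.
apply/tp_eqv; apply: eqv_imp => th hth.
have [f fP] : exists f : {x | (s @` B) x} -> {x | B x}, forall p, s (vl (f p)) = vl p.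
  have /choice[f fP] : forall p : {x | (s @` B) x}, exists q : {x | B x}, s (vl q) = vl p.
    by move=> [x px]; rewrite /vl /=; case: px => y By yx; exists (exist _ y By).
  by exists f.
have vE : @vl _ _ (s @` B) = s \o (@vl _ _ B \o f) by apply: funext => p /=; rewrite fP.
have sf : smallT K {x | (s @` B) x} by apply: small_sig.
rewrite (real_sat re); last by move=> [y hy]; right.
rewrite vE; apply: sP sf _; rewrite -(real_sat r2); last by move=> p; apply: proj2_sig.
by move: hth; rewrite vE -comp_jn (sat_aut sA'.1).
Qed.

End Ranks.

(** * Counting and pigeonhole for trees *)

Lemma infinite_pigeonhole (m : nat) (l : nat -> 'I_m) :
  exists x, forall i, exists2 j, (i <= j)%N & l j = x.
Proof.
apply: contrapT => nx.
have /choice[b bP] : forall x, exists b, forall j, (b <= j)%N -> l j <> x.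
  move=> x; apply: contrapT => nb; apply: nx; exists x => i.
  apply: contrapT => ni; apply: nb; exists i => j ij lj; apply: ni; by exists j.
apply: (bP (l (\max_x b x)) (\max_x b x)) => //; exact: leq_bigmax.
Qed.

Lemma size_count (m : nat) (w : seq 'I_m) : size w = \sum_(l < m) count_mem l w.
Proof.
elim: w => [|x w IH] /=; first by rewrite big1.
rewrite big_split /= -IH (bigD1 x) //= eqxx big1 // => l /negPf.
by rewrite eq_sym => ->.
Qed.

Lemma finite_bounded (X : Type) (F : set X) (f : X -> nat) :
  finite_set F -> exists N, forall x, F x -> (f x <= N)%N.
Proof.
move=> fF; have /finite_seqP[s sE] : finite_set (f @` F) by apply: finite_image.
exists (\max_(y <- s) y) => x Fx; apply: (@leq_bigmax_seq _ s xpredT id (f x)) => //.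
have : (f @` F) (f x) by exists x.
by rewrite sE.
Qed.

(** * Simple types *)

Section Simple.
Variables (L : language) (T : set (sentence L)) (M : structure L) (K : Type).
Hypothesis hM : monster M K T.

Let hK : uncountable_strong_limit K. Proof. by case: hM. Qed.
Let hS : saturated M K. Proof. by case: hM. Qed.
Let hH : strongly_homogeneous M K. Proof. by case: hM. Qed.

Lemma k_inconsistent_comp (n k : nat) (F : nat -> pformula M n) (f : nat -> nat) :
  injective f -> k_inconsistent k F -> k_inconsistent k (F \o f).
Proof. by move=> fI h i iI; apply: (h (f \o i)); apply: inj_comp. Qed.

Lemma k_inconsistent_leq (n k k' : nat) (F : nat -> pformula M n) :
  (k <= k')%N -> k_inconsistent k F -> k_inconsistent k' F.
Proof.
move=> kk h i iI [c cP]; apply: (h (i \o widen_ord kk)).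
  apply: inj_comp => // x y e; apply: val_inj.
  exact: (congr1 val e).
by exists c => l; apply: cP.
Qed.

Section Trees.
Variables (n m k : nat) (psi : 'I_m -> pformula M n).

(* [w] lists the indices of the formulas used at the successive levels; branches
   are consistent with [P]. *)
Fixpoint tree_over (w : seq 'I_m) (P : set ('I_n -> M)) : Prop :=
  match w with
  | [::] => P !=set0
  | l :: w' => exists b : nat -> 'I_(plen (psi l)) -> M,
      k_inconsistent k (fun i => PFormula (pfml (psi l)) (b i)) /\
      forall i, tree_over w' (P `&` [set c | psat c (PFormula (pfml (psi l)) (b i))])
  end.

Lemma tree_sub w (P Q : set ('I_n -> M)) : P `<=` Q -> tree_over w P -> tree_over w Q.
Proof.
elim: w P Q => [|l w IH] P Q PQ /=; first by move=> [c /PQ]; exists c.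
by move=> [b [kb h]]; exists b; split=> // i; apply: IH (h i); apply: setSI.
Qed.

Lemma tree_cons l w P : tree_over (l :: w) P -> tree_over w P.
Proof. by move=> [b [_ h]]; apply: tree_sub (h 0); apply: subIsetl. Qed.

(** By induction every child has a colour that works for its subtree; some colour recurs infinitely
    often, and passing to those children preserves [k]-inconsistency. *)
Lemma tree_split m' w (P : set ('I_n -> M)) (Q : 'I_m' -> set ('I_n -> M)) :
  (forall c, P c -> exists l, Q l c) -> tree_over w P ->
  exists l, tree_over w (P `&` Q l).
Proof.
elim: w P => [|l w IH] P PQ /=.
  by move=> [c Pc]; have [l Ql] := PQ c Pc; exists l, c.
move=> [b [kb h]].
have /choice[t tP] : forall i, exists t,
    tree_over w (P `&` [set c | psat c (PFormula (pfml (psi l)) (b i))] `&` Q t).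
  by move=> i; apply: IH => // c [/PQ].
have [x xP] := infinite_pigeonhole t; exists x.
have [f fi fx] := increasing_frequent xP.
have fI : injective f.
  move=> i j e; case: (ltngtP i j) => // /fi; by rewrite e ltnn.
exists (b \o f); split; first exact: k_inconsistent_comp fI kb.
by move=> i; apply: tree_sub (tP (f i)) => c [[Pc bc] Qc]; rewrite fx in Qc.
Qed.

Lemma tree_aut w (P : set ('I_n -> M)) (g h : M -> M) :
  automorphism g -> cancel g h -> cancel h g ->
  tree_over w P -> tree_over w [set c | P (h \o c)].
Proof.
move=> ag gh hg; have hgc (c : 'I_n -> M) : g \o (h \o c) = c.
  by apply: funext => i /=; rewrite hg.
elim: w P => [|l w IH] P /=.
  move=> [c Pc]; exists (g \o c) => /=.
  by have -> : h \o (g \o c) = c by apply: funext => i /=; rewrite gh.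
have E b c : psat c (PFormula (pfml (psi l)) (g \o b)) =
    psat (h \o c) (PFormula (pfml (psi l)) b).
  by rewrite -[in LHS](hgc c); apply: (@psat_cpf L M n g (PFormula (pfml (psi l)) b)).
move=> [b [kb hb]]; exists (fun i => g \o b i); split.
  move=> i iI [c cP]; apply: (kb i iI); exists (h \o c) => j.
  by rewrite -E.
by move=> i; apply: tree_sub (IH _ (hb i)) => c [/= Pc]; rewrite -E.
Qed.

(** Levels with another label are removed by continuing into one child only. *)
Lemma tree_count w l P : tree_over w P -> tree_over (nseq (count_mem l w) l) P.
Proof.
elim: w P => [|x w IH] P //=; have [->|ne] := eqVneq x l; last first.
  by move=> h; apply: IH; apply: (@tree_cons x).
by move=> [b [kb h]]; exists b; split=> // i; apply: IH.
Qed.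

Lemma tree_shorten i j l P : (i <= j)%N -> tree_over (nseq j l) P -> tree_over (nseq i l) P.
Proof. by elim: j => [|j IH]; [case: i|rewrite leq_eqVlt => /orP[/eqP -> //|/IH h /tree_cons]]. Qed.

Lemma tree_nodes h l (P : set ('I_n -> M)) : tree_over (nseq h l) P ->
  exists a : seq nat -> 'I_(plen (psi l)) -> M,
    (forall s, (size s < h)%N ->
       k_inconsistent k (fun j => PFormula (pfml (psi l)) (a (rcons s j)))) /\
    (forall s, size s = h -> exists2 c, P c & forall i, (0 < i <= h)%N ->
       psat c (PFormula (pfml (psi l)) (a (take i s)))).
Proof.
elim: h P => [|h IH] P /=.
  move=> [c Pc]; exists (fun _ => par (psi l)); split=> // s _; exists c => // i.
  by case: i.
move=> [b [kb hb]]; have /choice[a aP] := fun i => IH _ (hb i).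
(* The value at the empty sequence is a filler: only nonempty nodes carry formulas. *)
exists (fun s => match s with
  | [::] => b 0
  | i :: s' => if s' is [::] then b i else a i s'
  end); split.
  move=> [|i s] /=; first by move=> _; exact: kb.
  rewrite ltnS => sh; have := (aP i).1 s sh; congr k_inconsistent.
  by apply: funext => j; case: s {sh}.
move=> [//|i s] [sh]; have [c [Pc bc] ac] := (aP i).2 s sh; exists c => // -[//|j] /=.
rewrite ltnS => jh; case E : (take j s) => [|x t] //.
rewrite -E; apply: ac; rewrite jh andbT lt0n; apply/eqP => j0.
by move: E; rewrite j0 take0.
Qed.

End Trees.

(* If dividing formulas [psi l] cover the type, a tree is always consistent with
   one of them, and conjugates of the tree go below the conjugates of [psi l] that
   witness its dividing: trees grow for ever, and some [l] fills arbitrarily many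
   levels. *)
Theorem simple_nonforking (n : nat) (A : set M) (c0 : 'I_n -> M) :
  small K A -> simple_type (tp A c0) -> ~ forks A (tp A c0).
Proof.
move=> sA simp [D [fD dD hD]]; apply: simp.
have /finite_seqP[ds dsE] : finite_set (D : set {classic pformula M n}) by [].
pose m := size ds.
have Dnth psi : D psi -> exists l : 'I_m, tnth (in_tuple ds) l = psi :> {classic pformula M n}.
  move=> h; have : ([set` ds] : set {classic pformula M n}) psi by rewrite -dsE.
  by move=> /= /seq_tnthP[l ->]; exists l.
pose psi (l : 'I_m) : pformula M n := tnth (in_tuple ds) l.
have Dpsi l : D (psi l).
  have : ([set` ds] : set {classic pformula M n}) (psi l) by rewrite /= mem_tnth.
  by rewrite -dsE.
have /choice[kl klP] : forall l, exists k, exists g : nat -> M -> M,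
    (forall i, aut_over A (g i)) /\ k_inconsistent k (fun i => cpf (g i) (psi l)).
  by move=> l; have [k [g gP]] := divides_aut hM sA (dD _ (Dpsi l)); exists k, g.
(* One [k] must serve all formulas, and trees against simplicity require at least [2]. *)
pose k := maxn 2 (\max_l kl l).
have /choice[g gP] : forall l, exists g : nat -> M -> M,
    (forall i, aut_over A (g i)) /\ k_inconsistent k (fun i => cpf (g i) (psi l)).
  move=> l; have [g [gA gk]] := klP l; exists g; split=> //.
  apply: k_inconsistent_leq gk; rewrite /k leq_max; apply/orP; right.
  exact: leq_bigmax.
pose P : set ('I_n -> M) := [set c | eqv A c0 c].
have Pcov c : P c -> exists l, psat c (psi l).
  move=> Pc; have [chi Dchi hchi] := hD c (eqv_realizes Pc).
  by have [l lE] := Dnth _ Dchi; exists l; rewrite /psi lE.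
have words N : exists2 w, size w = N & tree_over k psi w P.
  elim: N => [|N [w wN hw]]; first by exists [::] => //; exists c0; apply: eqv_refl.
  have [l hl] := tree_split Pcov hw.
  exists (l :: w); first by rewrite /= wN.
  exists (fun i => g l i \o par (psi l)); split; first exact: (gP l).2.
  move=> i; have gA := (gP l).1 i; have [h [hA gh hg]] := aut_over_inv gA.
  apply: tree_sub (tree_aut gA.1 gh hg hl) => c [Pc hc].
  have cE : c = g l i \o (h \o c) by apply: funext => j /=; rewrite hg.
  split; first by apply: eqv_trans Pc _; apply: aut_eqv.
  by rewrite /= cE; have := psat_cpf (psi l) (h \o c) gA.1; rewrite /cpf => ->.
have [l hl] : exists l, forall h, tree_over k psi (nseq h l) P.
  apply: contrapT => nl.
  have /choice[h hP] : forall l, exists h, ~ tree_over k psi (nseq h l) P.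
    move=> l; apply: contrapT => nh; apply: nl; exists l => h.
    by apply: contrapT => nt; apply: nh; exists h.
  (* If no label [l] could fill [h l] levels, every word would have length at most this sum; one
     more letter is a contradiction. *)
  have [w wN hw] := words (\sum_l h l).+1.
  have : (size w <= \sum_l h l)%N.
    rewrite size_count; apply: leq_sum => l _; rewrite leqNgt; apply/negP => lt.
    by apply: (hP l); apply: tree_shorten (ltnW lt) (tree_count l hw).
  by rewrite wN ltnn.
set phi := pfml (psi l); set pl := plen (psi l) in phi *.
(* Besides the parameters, a realization for every node is part of the tuple, so that consistency of
   branches becomes a set of formulas surviving in the limit. *)
pose V := (seq nat * 'I_pl + seq nat * 'I_n)%type.
have sV : smallT K V.
  have ss : smallT K (seq nat) by apply: small_seq => //; apply: small_nat.
  by apply: small_sum => //; apply: small_prod => //; apply: small_fin.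
pose mk (a : seq nat -> 'I_pl -> M) (cc : seq nat -> 'I_n -> M) : V -> M :=
  jn (fun p => a p.1 p.2) (fun p => cc p.1 p.2).
pose good h a cc :=
  (forall s, (size s < h)%N -> k_inconsistent k (fun j => PFormula phi (a (rcons s j)))) /\
  (forall s, (size s <= h)%N -> P (cc s) /\ forall i, (0 < i <= size s)%N ->
     psat (cc s) (PFormula phi (a (take i s)))).
pose S h := [set v | exists a cc, good h a cc /\ v = mk a cc].
have [||v0 v0P] := @directed_realized _ _ K _ (ultra_realized_small hK hS sV) A
  nat 0 S sA.
- move=> h; have [a [ka ca]] := tree_nodes (hl h).
  have /choice[cc ccP] : forall s : seq nat, exists c, (size s <= h)%N -> P c /\
      forall i, (0 < i <= size s)%N -> psat c (PFormula phi (a (take i s))).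
    move=> s; have [sh|sh] := leqP (size s) h; last by exists c0.
    (* [tree_nodes] realizes full branches only, so a shorter node is prolonged by zeros. *)
    have [|c Pc ac] := ca (s ++ nseq (h - size s) 0).
      by rewrite size_cat size_nseq subnKC.
    exists c => _; split=> // i /andP[i0 i1].
    by have := ac i; rewrite takel_cat // i0 (leq_trans i1 sh); apply.
  by exists (mk a cc), a, cc; split.
- move=> h h'; exists (maxn h h') => _ [a [cc [[g1 g2] ->]]].
  by split; exists a, cc; split=> //; split=> s sh; try apply: g1; try apply: g2;
    rewrite leq_max sh ?orbT.
pose a s (j : 'I_pl) := v0 (inl (s, j)); pose cc s (i : 'I_n) := v0 (inr (s, i)).
exists pl, phi, k, a; split; first by rewrite /k leq_maxl.
  have ccA s : eqv A c0 (cc s).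
    apply: eqv_imp => th hth.
    pose f (t : 'I_n + {x | A x}) : V + {x | A x} :=
      match t with inl i => inl (inr (s, i)) | inr q => inr q end.
    have e v : jn (fun i => v (inr (s, i))) (@vl _ _ A) = jn v (@vl _ _ A) \o f.
      by apply: funext => -[].
    rewrite /cc e -sat_ren; apply: v0P; exists (size s) => v [a' [cc' [[_ g2] ->]]].
    rewrite sat_ren -e; have -> : (fun i => mk a' cc' (inr (s, i))) = cc' s by apply: funext.
    by have [Pc _] := g2 s (leqnn _); rewrite -Pc.
  have cca s i : (0 < i <= size s)%N -> psat (cc s) (PFormula phi (a (take i s))).
    move=> hi.
    pose f (t : 'I_n + 'I_pl) : V + {x | A x} :=
      match t with inl x => inl (inr (s, x)) | inr x => inl (inl (take i s, x)) end.
    have e v : jn (fun x => v (inr (s, x))) (fun x => v (inl (take i s, x))) =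
        jn v (@vl _ _ A) \o f by apply: funext => -[].
    change (sat phi (jn (cc s) (a (take i s)))).
    rewrite /cc /a e -sat_ren; apply: v0P; exists (size s) => v [a' [cc' [[_ g2] ->]]].
    by rewrite sat_ren -e; have [_] := g2 s (leqnn _); apply.
  move=> f F fF FP.
  have /choice[lev levP] : forall chi, exists N, F chi -> tp A c0 chi \/
      (0 < N)%N /\ chi = PFormula phi (a (mkseq f N)).
    move=> chi; have [Fchi|nF] := pselect (F chi); last by exists 0.
    have [h|[N N0 <-]] := FP _ Fchi; first by exists 0; left.
    by exists N; right.
  have [N NP] := finite_bounded lev fF.
  exists (cc (mkseq f N)) => chi Fchi; have [tchi|[l0 ->]] := levP chi Fchi.
    exact: eqv_realizes (ccA _) _ tchi.
  have -> : mkseq f (lev chi) = take (lev chi) (mkseq f N).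
    by rewrite /mkseq -map_take take_iota; rewrite (minn_idPl (NP _ Fchi)).
  by apply: cca; rewrite l0 size_mkseq NP.
move=> s i iI; have [theta thetaP] := kinconsistent_formula M k phi.
have -> : (exists c, forall j, psat c (PFormula phi (a (rcons s (i j))))) =
   (exists c, forall j, sat phi (jn c (a (rcons s (i j))))) by [].
rewrite -(thetaP (fun j => a (rcons s (i j)))).
pose f (t : 'I_k * 'I_pl) : V + {x | A x} := inl (inl (rcons s (i t.1), t.2)).
have -> : (fun p => a (rcons s (i p.1)) p.2) = jn v0 (@vl _ _ A) \o f by [].
rewrite -sat_ren.
apply: (v0P (fNot (ren theta f))); exists (size s).+1 => v [a' [cc' [[g1 _] ->]]].
rewrite /= sat_ren.
have -> : jn (mk a' cc') (@vl _ _ A) \o f = (fun p => (fun j => a' (rcons s (i j))) p.1 p.2).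
  by apply: funext.
by rewrite (thetaP (fun j => a' (rcons s (i j)))); apply: (g1 s (ltnSn _) i iI).
Qed.

End Simple.

Theorem proposition2p23 (L : language) (T : set (sentence L))
    (hT : complete_theory T) (M : structure L) (K : Type)
    (hM : monster M K T)
    (C : forall n : nat, set (set (pformula M n))) (hC : type_class K C)
    (d : Order.disp_t) (W : orderType d)
    (hW : well_founded (fun x y : W => (x < y)%O))
    (R : forall n : nat, set (pformula M n) -> option W)
    (hR : is_rank C R) :
  (bounded_multiplicity K C R -> extension K C R ->
     reciprocal_forking_rank K C R) /\
  ((forall (n : nat) (p : set (pformula M n)),
      C n p -> ranked R p -> simple_type p) ->
     reciprocal_forking_rank K C R -> extension K C R).
Proof.
split.
  move=> hB hE n A B p q sA sB cp cq Cp Cq pq rp nf.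
  have [c qc] := complete_realized hM sB cq.
  have pc : p = tp A c by apply: realized_complete => // psi /pq; rewrite qc => -[].
  (* Only [p] contained in [q] is given. A true formula with the dummy parameter [x], or its
     negation, lies in [p], hence in [q], which forces [x] into [B]. *)
  have AB : A `<=` B.
    move=> x Ax; pose psi : pformula M n :=
      @PFormula L M n 1 (ftrue L _) (fun=> x).
    have : q psi \/ q (pneg psi).
      by have [_ _ /(_ psi (fun _ => Ax))[h|h]] := cp; [left|right]; apply: pq.
    by case: cq => qB _ _ [/qB /(_ ord0)|/qB /(_ ord0)].
  by rewrite qc pc; apply: (nonforking_same_rank hM hC hW hR hB hE) => //; rewrite -?qc -?pc.
move=> hs hF n A p sA cp Cp rp B sB AB.
have [c pc] := complete_realized hM sA cp.
have sp : simple_type (tp A c) by rewrite -pc; apply: hs.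
have nf := simple_nonforking hM sA sp.
have [c' cc' nf'] := nonforking_extension hM sB AB nf.
have pq : p `<=` tp B c'.
  by rewrite pc; have /tp_eqv -> := cc'; apply: tp_sub.
exists (tp B c'); split=> //; first exact: complete_tp.
apply: esym; apply: (hF n A B) => //; first exact: complete_tp.
by case: hC => _ h _; apply: h Cp sB (complete_tp _ _) pq.
Qed.
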